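(* Let $\Omega$ be a domain in $\mathbb C^n$ and $1<p<\infty$. Suppose that $f=u+iv$ is holomorphic on $\Omega$ (with $u,v$ real-valued), that $v(z_0)=0$ for some $z_0\in\Omega$, and that $u\in h^p(\Omega)$. Then $f\in H^p(\Omega)$ and $$\|f\|_{p,z_0}\le C_p\,\|u\|_{p,z_0},$$ where $C_p$ is a constant depending only on $p$ (and not on $\Omega$, $z_0$, or $f$).
   Context: For $0<p<\infty$, the harmonic Hardy space $h^p(\Omega)$ is the set of all (real) harmonic functions $u$ on $\Omega$ (harmonic with respect to the Euclidean Laplacian on $\mathbb C^n\cong\mathbb R^{2n}$) such that $|u|^p$ admits a harmonic majorant on $\Omega$. For $z_0\in\Omega$ and $1\le p<\infty$, $\|u\|_{p,z_0}:=\left(\inf\{U(z_0): U \text{ harmonic on }\Omega,\ |u|^p\le U\}\right)^{1/p}$, i.e. $\|u\|_{p,z_0}^p$ is the value at $z_0$ of the least harmonic majorant of $|u|^p$. The holomorphic Hardy space $H^p(\Omega)$ is the set of holomorphic $f$ on $\Omega$ with both $\mathrm{Re}\,f$ and $\mathrm{Im}\,f$ in $h^p(\Omega)$, and for such $f$, $\|f\|_{p,z_0}$ is defined in the same way with $|u|^p$ replaced by $|f|^p$. Equivalently, for any increasing exhaustion $\{\Omega_t\}$ of $\Omega$ by relatively compact domains containing $z_0$, $\|u\|_{p,z_0}=\sup_t\left[\int_{\partial\Omega_t}|u|^p\,d\omega_{z_0,t}\right]^{1/p}$, where $d\omega_{z_0,t}$ is the harmonic measure of $\Omega_t$ relative to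 $z_0$ (and similarly for $|f|$). *)

(* Defs.v *)
From HB Require Import structures.
From mathcomp Require Import all_boot all_order all_algebra.
From mathcomp Require Import all_classical all_reals all_analysis.
Set Implicit Arguments. Unset Strict Implicit. Unset Printing Implicit Defensive.
Import Order.TTheory GRing.Theory Num.Theory.
Import numFieldNormedType.Exports.
Local Open Scope classical_set_scope.
Local Open Scope ring_scope.

(* C^n is identified with R^{2n} = R^n x R^n via z = x + i y. *)
Definition Cn (R : realType) (n : nat) := ('rV[R]_n * 'rV[R]_n)%type.

Definition ej {R : realType} {n : nat} (j : 'I_n) : 'rV[R]_n :=
  \row_(k < n) (k == j)%:R.

Definition dx {R : realType} {n : nat} (j : 'I_n) : Cn R n := (@ej R n j, 0).
Definition dy {R : realType} {n : nat} (j : 'I_n) : Cn R n := (0, @ej R n j).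

Definition C2_on (R : realType) (n : nat) (Om : set (Cn R n)) (u : Cn R n -> R) :=
  (forall z, Om z -> differentiable u z) /\
  (forall a : Cn R n, forall z, Om z -> differentiable (fun w => 'D_a u w) z) /\
  (forall a b : Cn R n, {within Om, continuous (fun w => 'D_b ('D_a u) w)}).

Definition laplacian (R : realType) (n : nat) (u : Cn R n -> R) (z : Cn R n) : R :=
  \sum_(j < n) ('D_(@dx R n j) ('D_(@dx R n j) u) z + 'D_(@dy R n j) ('D_(@dy R n j) u) z).

Definition harmonic_on (R : realType) (n : nat) (Om : set (Cn R n)) (u : Cn R n -> R) :=
  C2_on Om u /\ (forall z, Om z -> laplacian u z = 0).

(* f = u + i v is holomorphic on Om: real (Frechet) differentiable with
   C-linear differential, i.e. the Cauchy-Riemann equations in each variable *)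
Definition holomorphic_on (R : realType) (n : nat) (Om : set (Cn R n))
  (u v : Cn R n -> R) :=
  (forall z, Om z -> differentiable u z /\ differentiable v z) /\
  (forall z, Om z -> forall j : 'I_n,
      'D_(@dx R n j) u z = 'D_(@dy R n j) v z /\ 'D_(@dy R n j) u z = - 'D_(@dx R n j) v z).

Definition majorant_values (R : realType) (n : nat) (Om : set (Cn R n))
  (g : Cn R n -> R) (z0 : Cn R n) : set R :=
  [set U z0 | U in [set U | harmonic_on Om U /\ forall z, Om z -> g z <= U z]].

Definition has_harmonic_majorant (R : realType) (n : nat) (Om : set (Cn R n))
  (g : Cn R n -> R) := exists U, harmonic_on Om U /\ forall z, Om z -> g z <= U z.

Definition hp (R : realType) (n : nat) (p : R) (Om : set (Cn R n)) (u : Cn R n -> R) :=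
  harmonic_on Om u /\ has_harmonic_majorant Om (fun z => `|u z| `^ p).

Definition Hp (R : realType) (n : nat) (p : R) (Om : set (Cn R n)) (u v : Cn R n -> R) :=
  holomorphic_on Om u v /\ hp p Om u /\ hp p Om v.

Definition hp_norm (R : realType) (n : nat) (p : R) (Om : set (Cn R n))
  (z0 : Cn R n) (u : Cn R n -> R) : R :=
  (inf (majorant_values Om (fun z => `|u z| `^ p) z0)) `^ p^-1.

Definition Hp_norm (R : realType) (n : nat) (p : R) (Om : set (Cn R n))
  (z0 : Cn R n) (u v : Cn R n -> R) : R :=
  (inf (majorant_values Om (fun z => (Num.sqrt (u z ^+ 2 + v z ^+ 2)) `^ p) z0)) `^ p^-1.

(* Main.v *)
Require Import Defs.
From HB Require Import structures.
From mathcomp Require Import all_boot all_order all_algebra.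
From mathcomp Require Import all_classical all_reals all_analysis.
From mathcomp Require Import ring lra.
Set Implicit Arguments. Unset Strict Implicit. Unset Printing Implicit Defensive.
Import Order.TTheory GRing.Theory Num.Theory.
Import numFieldNormedType.Exports.
Local Open Scope classical_set_scope.
Local Open Scope ring_scope.

(** Riesz's inequality reduces to a sandwich.  Put rho = u^2 + v^2 + eps and
    a = p / 2, so that g = rho^a is subharmonic and dominates |f|^p.  By the
    Cauchy-Riemann equations g <= C U + T, where U is a harmonic majorant of
    |u|^p and T is superharmonic with T(z0) <= o(1) as eps -> 0, because
    v(z0) = 0: for a >= 1 take T = 2 (rho^a - 2 a^2 rho^(a-1) u^2), for a < 1
    take T = rho^a - q (u^2 + eps)^a + q eps^a with q = 2 / (2 a - 1).  A harmonic
    function between g and w = C U + T then majorizes |f|^p and has the required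
    value at z0.

    A harmonic function between a subharmonic g and a superharmonic w >= g is
    built from finite differences.  On a compact K_m of an exhaustion, with a
    small step h_m, the supremum F_m of the discrete subharmonic functions below
    w is discrete harmonic.  Bernstein's method (maximum principle for
    (eta DF)^2 + lambda F^2 with a quadratic cutoff eta) bounds difference
    quotients of discrete harmonic functions by their sup norm, and difference
    quotients are again discrete harmonic, so all of them are locally bounded
    uniformly in m.  The limit of F_m along an ultrafilter is therefore smooth,
    its derivatives are the limits of the difference quotients, and its
    Laplacian vanishes. *)

(** * Coordinates on C^n *)

Section Coordinates.
Context {R : realType} {n : nat}.
Implicit Types (z w : Cn R n) (d : bool * 'I_n) (h t r : R).

Definition dirv d : Cn R n := if d.1 then dx d.2 else dy d.2.
Definition coord d z : R := if d.1 then z.1 0 d.2 else z.2 0 d.2.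

Lemma coordD d z w : coord d (z + w) = coord d z + coord d w.
Proof. by rewrite /coord; case: ifP; rewrite mxE. Qed.
Lemma coordN d z : coord d (- z) = - coord d z.
Proof. by rewrite /coord; case: ifP; rewrite mxE. Qed.
Lemma coordZ d t z : coord d (t *: z) = t * coord d z.
Proof. by rewrite /coord; case: ifP; rewrite mxE. Qed.
Lemma coord_dirv d d' : coord d (dirv d') = (d == d')%:R.
Proof.
by case: d d' => [[] i] [[] j]; rewrite /coord /dirv /= ?mxE// xpair_eqE.
Qed.
Lemma coord0 d : coord d 0 = 0.
Proof. by rewrite /coord; case: ifP; rewrite mxE. Qed.
Lemma coord_sum I (s : seq I) (f : I -> Cn R n) d :
  coord d (\sum_(i <- s) f i) = \sum_(i <- s) coord d (f i).
Proof. by elim/big_rec2: _ => [|i x y _ <-]; rewrite ?coord0// coordD. Qed.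

Lemma coord_inj z w : (forall d, coord d z = coord d w) -> z = w.
Proof.
case: z w => [x y] [x' y'] H; congr pair; apply/rowP => j.
  exact: (H (true, j)).
exact: (H (false, j)).
Qed.

Lemma coord_decomp z : z = \sum_d coord d z *: dirv d.
Proof.
apply: coord_inj => d; rewrite coord_sum (bigD1 d)//= coordZ coord_dirv eqxx mulr1.
rewrite big1 ?addr0// => d' /negPf dd'.
by rewrite coordZ coord_dirv eq_sym dd' mulr0.
Qed.

Lemma norm_coord z d : `|coord d z| <= `|z|.
Proof.
have norm_row (x : 'rV[R]_n) j : `|x 0 j| <= `|x|.
  rewrite /Num.norm/= mx_normrE.
  exact: (le_bigmax _ (fun ij : 'I_1 * 'I_n => `|x ij.1 ij.2|) (0, j)).
by rewrite prod_normE /coord le_max; case: d.1; rewrite norm_row ?orbT.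
Qed.

Lemma coord_norm_le z r : 0 <= r -> (forall d, `|coord d z| <= r) -> `|z| <= r.
Proof.
move=> r0 H; rewrite prod_normE ge_max /Num.norm/= !mx_normrE.
by apply/andP; split; apply: bigmax_le => // -[i j] _ /=;
  rewrite (ord1 i); [exact: (H (true, j))|exact: (H (false, j))].
Qed.

Lemma norm_dirv d : `|dirv d| = 1.
Proof.
apply/eqP; rewrite eq_le; apply/andP; split.
  by apply: coord_norm_le => // d'; rewrite coord_dirv; case: eqP; rewrite ?normr1 ?normr0.
by have := norm_coord (dirv d) d; rewrite coord_dirv eqxx normr1.
Qed.

Lemma normZ_dirv t d : `|t *: dirv d| = `|t|.
Proof. by rewrite normrZ norm_dirv mulr1. Qed.

Lemma coord_continuous d : continuous (coord d).
Proof.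
move=> z; apply/cvgrPdist_lt => e e0.
near=> w; apply: (@le_lt_trans _ _ `|z - w|); first by rewrite -coordN -coordD norm_coord.
by near: w; apply: cvgr_dist_lt.
Unshelve. all: by end_near. Qed.

End Coordinates.

(** * Finite differences *)

Section DiscreteLaplacian.
Context {R : realType} {n : nat}.
Local Notation sdir := (bool * (bool * 'I_n))%type.
Implicit Types (z w c : Cn R n) (d : bool * 'I_n) (s : sdir) (h : R)
  (F G : Cn R n -> R).

Definition nb h s z : Cn R n :=
  if s.1 then z + h *: dirv s.2 else z - h *: dirv s.2.

(* [h ^ 2] times the usual difference Laplacian. *)
Definition Lap h G z : R := \sum_s (G (nb h s z) - G z).

Lemma LapE h G z :
  Lap h G z = \sum_d (G (z + h *: dirv d) + G (z - h *: dirv d) - 2 * G z).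
Proof.
rewrite /Lap -(pair_bigA _ (fun b d => G (nb h (b, d) z) - G z))/= big_bool/=.
rewrite -big_split/=; apply: eq_bigr => d _; rewrite /nb/=; ring.
Qed.

Lemma nbC h s s' z : nb h s (nb h s' z) = nb h s' (nb h s z).
Proof. by rewrite /nb; do 2 case: ifP => _; rewrite addrAC. Qed.

Lemma nb_shift h s z w : nb h s (z + w) = nb h s z + w.
Proof. by rewrite /nb; case: ifP => _; rewrite addrAC. Qed.

Lemma nb_norm h s z : 0 <= h -> `|nb h s z - z| = h.
Proof.
move=> h0; rewrite /nb; case: ifP => _.
  by rewrite [z + _]addrC addrK normZ_dirv ger0_norm.
by rewrite [z - _]addrC addrK normrN normZ_dirv ger0_norm.
Qed.

Lemma nb_dist h s z c r : 0 <= h -> `|z - c| <= r -> `|nb h s z - c| <= r + h.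
Proof.
move=> h0 zr; rewrite -(subrK z (nb h s z)) -addrA.
by apply: (le_trans (ler_normD _ _)); rewrite nb_norm// [r + h]addrC lerD2l.
Qed.

Lemma LapD h F G z : Lap h (fun w => F w + G w) z = Lap h F z + Lap h G z.
Proof. by rewrite /Lap -big_split; apply: eq_bigr => s _ /=; ring. Qed.

Lemma LapZ h a F z : Lap h (fun w => a * F w) z = a * Lap h F z.
Proof. by rewrite /Lap mulr_sumr; apply: eq_bigr => s _; ring. Qed.

Lemma LapB h F G z : Lap h (fun w => F w - G w) z = Lap h F z - Lap h G z.
Proof.
by rewrite /Lap -sumrB; apply: eq_bigr => s _ /=; ring.
Qed.

Lemma Lap_cst h a z : Lap h (fun=> a) z = 0.
Proof. by rewrite /Lap big1// => s _; rewrite subrr. Qed.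

Lemma Lap_sum h I (r : seq I) (F : I -> Cn R n -> R) z :
  Lap h (fun w => \sum_(i <- r) F i w) z = \sum_(i <- r) Lap h (F i) z.
Proof.
by rewrite /Lap [RHS]exchange_big/=; apply: eq_bigr => s _; rewrite sumrB.
Qed.

Lemma Lap_nb h s F z : Lap h (fun w => F (nb h s w)) z = Lap h F (nb h s z).
Proof. by apply: eq_bigr => s' _; rewrite nbC. Qed.

(** Discrete form of [Delta F^2 = 2 |grad F|^2] for harmonic [F], from
    [b^2 - a^2 = (b - a)^2 + 2 a (b - a)]. This gain pays for the cutoff errors in Bernstein's
    method. *)
Lemma Lap_sq h F z : Lap h F z = 0 ->
  Lap h (fun w => F w ^+ 2) z = \sum_s (F (nb h s z) - F z) ^+ 2.
Proof.
move=> F0.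
transitivity (\sum_s (F (nb h s z) - F z) ^+ 2 + 2 * F z * Lap h F z).
  by rewrite /Lap mulr_sumr -big_split; apply: eq_bigr => s _ /=; ring.
by rewrite F0 mulr0 addr0.
Qed.

(** The square of the Euclidean norm, whereas the norm of [Cn R n] is the largest coordinate in
    absolute value. As a quadratic polynomial it has a constant difference Laplacian. *)
Definition normsq z : R := \sum_d coord d z ^+ 2.

Lemma normsq_ge0 z : 0 <= normsq z.
Proof. by apply: sumr_ge0 => d _; rewrite sqr_ge0. Qed.

Lemma coord_le_normsq d z : coord d z ^+ 2 <= normsq z.
Proof.
by rewrite /normsq (bigD1 d)//= lerDl sumr_ge0// => d' _; rewrite sqr_ge0.
Qed.

Lemma norm_le_normsq z r : 0 <= r -> normsq z <= r ^+ 2 -> `|z| <= r.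
Proof.
move=> r0 zr; apply: coord_norm_le => // d; rewrite -ler_sqr ?nnegrE// real_normK ?num_real//.
exact: le_trans (coord_le_normsq d z) zr.
Qed.

Lemma normsq_nb h s z : normsq (nb h s z) =
  normsq z + (if s.1 then 2 * h * coord s.2 z else - (2 * h * coord s.2 z)) + h ^+ 2.
Proof.
rewrite /normsq (bigD1 s.2)//= [in RHS](bigD1 s.2)//=.
rewrite (eq_bigr (fun d => coord d z ^+ 2)); last first.
  move=> d /negPf ds; rewrite /nb; case: ifP => _;
  by rewrite coordD ?coordN coordZ coord_dirv ds mulr0 ?oppr0 addr0.
rewrite /nb; case: ifP => _; rewrite coordD ?coordN coordZ coord_dirv eqxx/= ?mulr1n; ring.
Qed.

(** The number [4 n] of lattice neighbors of a point; it vanishes in dimension zero. *)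
Definition valence : R := #|{: sdir}|%:R.

Lemma valenceE : valence = \sum_(s : sdir) 1.
Proof. by rewrite sumr_const. Qed.

Lemma Lap_normsq h z : Lap h normsq z = valence * h ^+ 2.
Proof.
rewrite LapE valenceE mulr_suml.
rewrite -(pair_bigA _ (fun b (d : bool * 'I_n) => 1 * h ^+ 2))/= big_bool/= -big_split/=.
by apply: eq_bigr => d _; have := normsq_nb h (true, d) z;
  have := normsq_nb h (false, d) z; rewrite /nb/= => -> ->; ring.
Qed.

(* [Psi] need not attain its supremum over [S]: since [Lap h Psi] is bounded
   below by [theta], every near-maximum has a neighbor exceeding the supremum. *)
Lemma discrete_max_principle h theta K M (S : set (Cn R n)) (Psi : Cn R n -> R) :
  0 < theta -> (forall z, S z -> Psi z <= K) ->
  (forall z, S z -> theta <= Lap h Psi z) ->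
  (forall z s, S z -> S (nb h s z) \/ Psi (nb h s z) <= M) ->
  forall z, S z -> Psi z <= M.
Proof.
move=> th0 PsiK PsiLap Sb z0 Sz0; rewrite leNgt; apply/negP => Mz0.
have hs : has_sup (Psi @` S).
  split; first by exists (Psi z0); exists z0.
  by exists K => _ [z Sz <-]; exact: PsiK.
have vge0 : 0 <= valence by rewrite ler0n.
pose del := theta / (valence + 1).
have del0 : 0 < del by rewrite divr_gt0// ltr_wpDl.
have [_ [x Sx <-] xsup] := sup_adherent del0 hs.
have [s sx] : exists s, Psi x + del <= Psi (nb h s x).
  apply: contrapT => /forallNP H.
  have := PsiLap _ Sx; rewrite leNgt => /negP; apply.
  apply: (@le_lt_trans _ _ (\sum_(s : sdir) del)).
    by apply: ler_sum => s _; have /negP := H s; rewrite -ltNge => /ltW; rewrite lerBlDl.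
  rewrite sumr_const -mulr_natr /del mulrAC ltr_pdivrMr ?ltr_wpDl//.
  by rewrite ltr_pM2l// ltrDl.
have ub z : S z -> Psi z <= sup (Psi @` S) by move=> Sz; apply: ub_le_sup; [case: hs|exists z].
have := ub _ Sz0; have [Snb|PsiM] := Sb x s Sx; last by lra.
by have := ub _ Snb; lra.
Qed.

End DiscreteLaplacian.
Arguments valence : clear implicits.

(** * Interior gradient estimate for discrete harmonic functions *)

Section DiscreteGradient.
Context {R : realType} {n : nat}.
Implicit Types (z w c : Cn R n) (d : bool * 'I_n) (s : bool * (bool * 'I_n)) (h : R).

(** Here [a], [b] are the values of the cutoff at a point and at a neighbor, and [s], [t] those of
    the function being cut off. Summed over neighbors, the two first-order terms become Laplacians,
    and the error is quadratic in the variation of the cutoff. The difference of the two sides is a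
    sum of squares. *)
Lemma cutoff_term (a b s t : R) :
  b ^+ 2 * t ^+ 2 - a ^+ 2 * s ^+ 2 >=
  2 * a ^+ 2 * s * (t - s) + 2 * a * s ^+ 2 * (b - a)
  - (3 * s ^+ 2 + t ^+ 2) * (b - a) ^+ 2.
Proof.
rewrite -subr_ge0.
have -> : b ^+ 2 * t ^+ 2 - a ^+ 2 * s ^+ 2 -
   (2 * a ^+ 2 * s * (t - s) + 2 * a * s ^+ 2 * (b - a) -
    (3 * s ^+ 2 + t ^+ 2) * (b - a) ^+ 2) =
   (b * (t - s) + 2 * (b - a) * s) ^+ 2 + (b - a) ^+ 2 * (t - s) ^+ 2
   + s ^+ 2 * (b - a) ^+ 2 by ring.
by rewrite !addr_ge0// ?sqr_ge0// mulr_ge0 ?sqr_ge0.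
Qed.

(* Below, [k = h / r], [eta = 1 - |z - c|^2 / r^2], [G] is the difference of [F]
   and the maximum principle is applied to
   [(eta G)^2 + cutoff_const k^2 Phi + k^2 (B / r)^2 |z - c|^2], where [Phi]
   sums [F^2] over a point and its neighbors and the last term makes the
   subharmonicity strict. *)
Let cutoff_const : R := 29 * valence R n + 9.
Definition gradient_const : R :=
  40 + cutoff_const * (1 + valence R n).

Lemma gradient_const_ge1 : 1 <= gradient_const.
Proof.
rewrite /gradient_const /cutoff_const.
have v0 : 0 <= valence R n by rewrite ler0n.
have := mulr_ge0 v0 v0; nra.
Qed.

Lemma discrete_gradient_bound (F : Cn R n -> R) c d (h r B : R) :
  0 < h -> h <= r -> 0 < B ->
  (forall z, `|z - c| <= 3 * r -> `|F z| <= B /\ Lap h F z = 0) ->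
  `|F (c + h *: dirv d) - F c| <= gradient_const * B * (h / r).
Proof.
move=> h0 hr B0 HF; have r0 : 0 < r by exact: lt_le_trans hr.
pose s0 : bool * (bool * 'I_n) := (true, d).
pose v := valence R n.
have v0 : 0 <= v by rewrite ler0n.
have v1 : 1 <= v.
  by rewrite /v /valence ler1n; apply/card_gt0P; exists s0.
set k := h / r; have k0 : 0 < k by rewrite divr_gt0.
have k0' := ltW k0; have B0' := ltW B0; have r0' := ltW r0.
have k1 : k <= 1 by rewrite ler_pdivrMr ?mul1r.
have hE : h = k * r by rewrite /k divfK// gt_eqF.
pose G z := F (nb h s0 z) - F z.
pose q z := normsq (z - c).
pose eta z := 1 - q z / r ^+ 2.
pose Phi z := F z ^+ 2 + \sum_s F (nb h s z) ^+ 2.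
pose lam := cutoff_const * k ^+ 2.
pose kap := k ^+ 2 * B ^+ 2 / r ^+ 2.
have cc0 : 0 <= cutoff_const by rewrite /cutoff_const -/v; lra.
have lam0 : 0 <= lam by rewrite mulr_ge0// sqr_ge0.
have r20 : r ^+ 2 != 0 by rewrite sqrf_eq0 gt_eqF.
have kap0 : 0 < kap by rewrite !mulr_gt0 ?invr_gt0 ?exprn_gt0.
pose S := [set z | q z < r ^+ 2].
pose Psi z := (eta z ^+ 2 * G z ^+ 2 + lam * Phi z) + kap * q z.
have q0 z : 0 <= q z by exact: normsq_ge0.
have Snorm z : S z -> `|z - c| <= r by move=> Sz; apply: norm_le_normsq; apply/ltW.
have F1 z : `|z - c| <= 3 * r -> F z ^+ 2 <= B ^+ 2.
  by move=> /HF[FB _]; rewrite -ler_sqr ?nnegrE ?(ltW B0)// real_normK ?num_real// in FB.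
have Sn z s : S z -> `|nb h s z - c| <= r + h.
  by move=> /Snorm; apply: nb_dist; exact: ltW.
have Snn z s s' : S z -> `|nb h s' (nb h s z) - c| <= r + h + h.
  by move=> /Sn-/(_ s); apply: nb_dist; exact: ltW.
(* The argument evaluates [F] up to two steps outside the ball of radius [r], and [h <= r]; hence
   the radius [3 * r] in the hypothesis. *)
have le1 : r <= 3 * r by lra.
have le2 : r + h <= 3 * r by lra.
have le3 : r + h + h <= 3 * r by lra.
have S1 z : S z -> `|z - c| <= 3 * r by move=> /Snorm/le_trans; apply.
have S2 z s : S z -> `|nb h s z - c| <= 3 * r by move=> /Sn/le_trans; apply.
have S3 z s s' : S z -> `|nb h s' (nb h s z) - c| <= 3 * r by move=> /Snn/le_trans; apply.
have qnb z s : `|q (nb h s z) - q z| <= 2 * h * `|coord s.2 (z - c)| + h ^+ 2.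
  rewrite /q -nb_shift normsq_nb; set x := normsq _; set y := (if _ then _ else _).
  have -> : x + y + h ^+ 2 - x = y + h ^+ 2 by ring.
  rewrite (le_trans (ler_normD _ _))// lerD//; last by rewrite ger0_norm ?sqr_ge0.
  rewrite /y; by case: ifP => _; rewrite ?normrN !normrM ger0_norm// ger0_norm// ltW.
(* One step changes [q] by at most [2 h r + h^2 <= 3 h r]. *)
have etanb z s : S z -> `|eta (nb h s z) - eta z| <= 3 * k.
  move=> Sz; rewrite /eta.
  have -> : 1 - q (nb h s z) / r ^+ 2 - (1 - q z / r ^+ 2) =
            - ((q (nb h s z) - q z) / r ^+ 2) by ring.
  rewrite normrN normrM normfV [`|r ^+ 2|]ger0_norm ?sqr_ge0//.
  rewrite ler_pdivrMr ?exprn_gt0// (le_trans (qnb z s))//.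
  have := le_trans (norm_coord (z - c) s.2) (Snorm _ Sz).
  have := normr_ge0 (coord s.2 (z - c)).
  rewrite hE; move: `|_| => x x0 xr.
  have kr0 : 0 <= k * r by apply/ltW; rewrite mulr_gt0.
  have H1 : k * r * x <= k * r * r by rewrite ler_wpM2l.
  have H2 : k * r * (k * r) <= k * r * r by rewrite ler_wpM2l// ger_pMl.
  by rewrite !expr2; lra.
have etanb2 z s : S z -> (eta (nb h s z) - eta z) ^+ 2 <= 9 * k ^+ 2.
  move=> /etanb-/(_ s) H; have -> : 9 * k ^+ 2 = (3 * k) ^+ 2 by ring.
  rewrite -[leLHS]real_normK ?num_real// ler_sqr ?nnegrE//; lra.
have eta01 z : S z -> 0 <= eta z <= 1.
  move=> Sz; rewrite /eta gerBl divr_ge0 ?sqr_ge0// andbT subr_ge0.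
  by rewrite ler_pdivrMr ?exprn_gt0// mul1r ltW.
have LapEta z : Lap h eta z = - (v * k ^+ 2).
  rewrite /eta.
  rewrite (LapB h (fun=> 1) (fun w => q w / r ^+ 2)) Lap_cst sub0r.
  have -> : (fun w => q w / r ^+ 2) = (fun w => (r ^+ 2)^-1 * q w).
    by apply/funext => w; rewrite mulrC.
  rewrite LapZ; congr (- _); rewrite -/v.
  have -> : Lap h q z = Lap h normsq (z - c).
    by apply: eq_bigr => s _; rewrite /q -nb_shift.
  by rewrite Lap_normsq hE -/v; field; rewrite gt_eqF.
have LapG z : S z -> Lap h G z = 0.
  move=> Sz; rewrite /G LapB Lap_nb.
  by rewrite (HF _ (S1 _ Sz)).2 (HF _ (S2 _ s0 Sz)).2 subrr.
have LapGG z : S z -> Lap h (fun w => eta w ^+ 2 * G w ^+ 2) z >=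
    - lam * (G z ^+ 2 + \sum_s G (nb h s z) ^+ 2).
  move=> Sz; have etaz := eta01 _ Sz; have e0 := LapEta z; have g0 := LapG z Sz.
  set A := G z ^+ 2; set T := \sum_s _.
  have A0 : 0 <= A by rewrite sqr_ge0.
  have T0 : 0 <= T by apply: sumr_ge0 => s _; rewrite sqr_ge0.
  (* This is [cutoff_term] summed over the neighbors. As [Lap h G z = 0], [Lap h eta z = - v k^2]
     and [eta <= 1], the loss is at most [k^2 ((27 + 2) v A + 9 T)], which explains
     [cutoff_const]. *)
  apply: (@le_trans _ _ (2 * eta z ^+ 2 * G z * Lap h G z
     + 2 * eta z * A * Lap h eta z - 9 * k ^+ 2 * (3 * A * v + T))).
    rewrite g0 e0 mulr0 add0r -subr_ge0.
    have -> : 2 * eta z * A * - (v * k ^+ 2) - 9 * k ^+ 2 * (3 * A * v + T) -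
       - lam * (A + T) =
       k ^+ 2 * (2 * v * A * (1 - eta z) + 9 * A + 29 * v * T).
      by rewrite /lam /cutoff_const -/v; ring.
    have e1 : 0 <= 1 - eta z by lra.
    move: (1 - eta z) e1 => e e1.
    by do ?[exact: sqr_ge0|apply: addr_ge0|apply: mulr_ge0].
  rewrite /v valenceE /T !mulr_sumr -!big_split/= mulr_sumr -sumrB.
  apply: ler_sum => s _; apply: le_trans (cutoff_term _ _ _ _).
  have := etanb2 z s Sz; set e := (_ - eta z) => eb.
  rewrite lerB// -/A.
  have -> : 9 * k ^+ 2 * (3 * A * 1 + G (nb h s z) ^+ 2) =
    (3 * A + G (nb h s z) ^+ 2) * (9 * k ^+ 2) by ring.
  by rewrite ler_wpM2l// addr_ge0 ?sqr_ge0// mulr_ge0.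
have LapPhi z : S z -> Lap h Phi z >= G z ^+ 2 + \sum_s G (nb h s z) ^+ 2.
  move=> Sz; have sqG w : Lap h F w = 0 -> G w ^+ 2 <= Lap h (fun w => F w ^+ 2) w.
    move=> /Lap_sq ->; rewrite (bigD1 s0)//= lerDl sumr_ge0// => s _; exact: sqr_ge0.
  rewrite LapD Lap_sum lerD ?sqG ?(HF _ (S1 _ Sz)).2//.
  apply: ler_sum => s _; rewrite (Lap_nb h s (fun w => F w ^+ 2)).
  by rewrite sqG// (HF _ (S2 _ s Sz)).2.
have PsiLap z : S z -> kap * h ^+ 2 <= Lap h Psi z.
  move=> Sz; rewrite /Psi LapD (LapD h (fun w => eta w ^+ 2 * G w ^+ 2)) !LapZ.
  have -> : Lap h q z = v * h ^+ 2.
    by rewrite -(Lap_normsq h (z - c)); apply: eq_bigr => s _; rewrite /q -nb_shift.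
  rewrite -[leLHS]add0r lerD//.
    by have := LapGG z Sz; have := ler_wpM2l lam0 (LapPhi z Sz); lra.
  by rewrite ler_pM2l// ler_peMl// sqr_ge0.
have PhiB z : S z -> Phi z <= (1 + v) * B ^+ 2.
  move=> Sz; rewrite mulrDl mul1r; apply: lerD; first exact/F1/S1.
  rewrite /v valenceE mulr_suml.
  by apply: ler_sum => s _; rewrite mul1r; exact/F1/S2.
have PhiB' z s : S z -> Phi (nb h s z) <= (1 + v) * B ^+ 2.
  move=> Sz; rewrite mulrDl mul1r; apply: lerD; first exact/F1/S2.
  rewrite /v valenceE mulr_suml.
  by apply: ler_sum => s' _; rewrite mul1r; exact/F1/S3.
have sqB x y : x ^+ 2 <= B ^+ 2 -> y ^+ 2 <= B ^+ 2 -> (x - y) ^+ 2 <= 4 * B ^+ 2.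
  by move=> xB yB; have := sqr_ge0 (x + y); rewrite !expr2 in xB yB *; lra.
have GB z : S z -> G z ^+ 2 <= 4 * B ^+ 2.
  by move=> Sz; apply: sqB; apply: F1; [exact: S2|exact: S1].
have GB' z s : S z -> G (nb h s z) ^+ 2 <= 4 * B ^+ 2.
  by move=> Sz; apply: sqB; apply: F1; [exact: S3|exact: S2].
pose M := k ^+ 2 * B ^+ 2 * gradient_const.
have PsiK z : S z -> Psi z <= 4 * B ^+ 2 + lam * ((1 + v) * B ^+ 2) + kap * r ^+ 2.
  move=> Sz; rewrite /Psi !lerD//; last by rewrite ler_pM2l// ltW.
    have /andP[e0 e1] := eta01 z Sz.
    apply: le_trans (GB z Sz); rewrite ler_piMl ?sqr_ge0// expr_le1//.
  by rewrite ler_wpM2l// PhiB.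
(* A step leaving [S] takes [eta] from a nonnegative to a nonpositive value, so [eta^2 <= 9 k^2] at
   the exit point and every term of [Psi] is of order [k^2 B^2]. The 40 in [gradient_const] is
   [9 * 4] from the cutoff term plus 4 from [kap * q]. *)
have bdry z s : S z -> S (nb h s z) \/ Psi (nb h s z) <= M.
  move=> Sz; have [|nS] := ltP (q (nb h s z)) (r ^+ 2); [by left|right].
  have /andP[e0 e1] := eta01 z Sz.
  have := etanb z s Sz; rewrite ler_norml => /andP[e2 _].
  have eta0 : eta (nb h s z) <= 0.
    by rewrite /eta subr_le0 ler_pdivlMr ?exprn_gt0// mul1r.
  have eta9 : eta (nb h s z) ^+ 2 <= 9 * k ^+ 2.
    by rewrite -sqrrN; have : 0 <= - eta (nb h s z) <= 3 * k; [lra|nra].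
  have q4 : q (nb h s z) <= 4 * r ^+ 2.
    rewrite -ler_pdivrMr ?exprn_gt0//; move: e2; rewrite {1}/eta; lra.
  have -> : M = 9 * k ^+ 2 * (4 * B ^+ 2) + lam * ((1 + v) * B ^+ 2) + kap * (4 * r ^+ 2).
    by rewrite /M /gradient_const /lam /cutoff_const /kap -/v; field; rewrite gt_eqF.
  rewrite /Psi; apply: lerD; last by rewrite ler_pM2l.
  apply: lerD; last by apply: ler_wpM2l => //; exact: PhiB'.
  by apply: ler_pM; rewrite ?sqr_ge0//; exact: GB'.
have Sc : S c by rewrite /S/= /q subrr /normsq big1 ?exprn_gt0// => d' _; rewrite coord0 expr0n.
have := discrete_max_principle (mulr_gt0 kap0 (exprn_gt0 2 h0)) PsiK PsiLap bdry Sc.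
have qc : q c = 0 by rewrite /q subrr /normsq big1// => d' _; rewrite coord0 expr0n.
rewrite /Psi qc mulr0 addr0 /eta qc mul0r subr0 expr1n mul1r => GM.
have {}GM : G c ^+ 2 <= (gradient_const * B * k) ^+ 2.
  have Phi0 : 0 <= lam * Phi c.
    by rewrite mulr_ge0// addr_ge0 ?sqr_ge0// sumr_ge0// => s _; rewrite sqr_ge0.
  (* Since [gradient_const] is at least 1, it may be replaced by its square, which avoids a square
     root. *)
  have C1 := gradient_const_ge1.
  have : M <= (gradient_const * B * k) ^+ 2.
    have -> : M = gradient_const * (B * k) ^+ 2 by rewrite /M; ring.
    have -> : (gradient_const * B * k) ^+ 2 =
        gradient_const * gradient_const * (B * k) ^+ 2 by ring.
    by rewrite ler_wpM2r ?sqr_ge0// ler_peMl//; lra.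
  lra.
have gc0 : 0 <= gradient_const * B * k.
  have gc1 : 0 <= gradient_const := le_trans ler01 gradient_const_ge1.
  by apply: mulr_ge0 => //; apply: mulr_ge0.
by rewrite -[F _ - F c]/(G c) -ler_sqr ?nnegrE// real_normK ?num_real.
Qed.
End DiscreteGradient.
Arguments gradient_const : clear implicits.

(** * Lattice Taylor estimates and rounding to the lattice *)

Section DifferenceQuotients.
Context {R : realType} {n : nat}.
Implicit Types (z w c x : Cn R n) (d : bool * 'I_n) (h r B : R) (G : Cn R n -> R).

Definition diffq h d G z : R := (G (z + h *: dirv d) - G z) / h.

Lemma lattice_lipschitz h d G c r B : 0 < h ->
  (forall w, `|w - c| <= r -> `|diffq h d G w| <= B) ->
  forall (k : nat) x, `|x - c| + k%:R * h <= r ->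
  `|G (x + (k%:R * h) *: dirv d) - G x| <= k%:R * h * B.
Proof.
move=> h0 HB; elim=> [|k IH] x xr; first by rewrite !mul0r scale0r addr0 subrr normr0.
have kS : k.+1%:R * h = k%:R * h + h by rewrite -natr1 mulrDl mul1r.
rewrite kS in xr *; have xr' : `|x - c| + k%:R * h <= r by lra.
set y := x + (k%:R * h) *: dirv d.
have -> : x + (k%:R * h + h) *: dirv d = y + h *: dirv d by rewrite scalerDl addrA.
have -> : G (y + h *: dirv d) - G x = h * diffq h d G y + (G y - G x).
  by rewrite /diffq; field; rewrite gt_eqF.
rewrite (le_trans (ler_normD _ _))// mulrDl [leRHS]addrC lerD ?IH//.
rewrite normrM gtr0_norm// ler_pM2l// HB// (le_trans _ xr')// /y addrAC.
by rewrite (le_trans (ler_normD _ _))// lerD2l normZ_dirv ger0_norm// mulr_ge0// ltW.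
Qed.

(** By [lattice_lipschitz] applied to the first quotient, the slope after [k] steps differs from the
    initial slope by at most [k h B]; the next step therefore adds an error of at most
    [h (k h) B]. *)
Lemma lattice_taylor h d G c r B : 0 < h ->
  (forall w, `|w - c| <= r -> `|diffq h d (diffq h d G) w| <= B) ->
  forall (k : nat) x, `|x - c| + k%:R * h <= r ->
  `|G (x + (k%:R * h) *: dirv d) - G x - k%:R * h * diffq h d G x|
    <= (k%:R * h) ^+ 2 * B.
Proof.
move=> h0 HB; elim=> [|k IH] x xr.
  by rewrite !mul0r scale0r addr0 subrr sub0r oppr0 normr0 expr0n mul0r.
have kS : k.+1%:R * h = k%:R * h + h by rewrite -natr1 mulrDl mul1r.
rewrite kS in xr *; have xr' : `|x - c| + k%:R * h <= r by lra.
have Lip := lattice_lipschitz h0 HB xr'.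
set y := x + (k%:R * h) *: dirv d in Lip *.
have -> : x + (k%:R * h + h) *: dirv d = y + h *: dirv d by rewrite scalerDl addrA.
have -> : G (y + h *: dirv d) - G x - (k%:R * h + h) * diffq h d G x =
   h * (diffq h d G y - diffq h d G x) + (G y - G x - k%:R * h * diffq h d G x).
  by rewrite {2}/diffq; field; rewrite gt_eqF.
have kh0 : 0 <= k%:R * h by rewrite mulr_ge0// ltW.
have B0 : 0 <= B.
  have xc : `|x - c| <= r by lra.
  exact: le_trans (normr_ge0 _) (HB _ xc).
rewrite (le_trans (ler_normD _ _))//.
apply: (@le_trans _ _ (h * (k%:R * h * B) + (k%:R * h) ^+ 2 * B)).
  by rewrite lerD ?IH// normrM gtr0_norm// ler_pM2l.
rewrite -subr_ge0.
have -> : (k%:R * h + h) ^+ 2 * B - (h * (k%:R * h * B) + (k%:R * h) ^+ 2 * B) =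
  h * (k%:R * h) * B + h * h * B by ring.
by rewrite addr_ge0// !mulr_ge0// ltW.
Qed.

Definition rnd h z : Cn R n :=
  \sum_d (Num.floor (coord d z / h))%:~R * h *: dirv d.

Lemma coord_rnd h d z : coord d (rnd h z) = (Num.floor (coord d z / h))%:~R * h.
Proof.
rewrite coord_sum (bigD1 d)//= coordZ coord_dirv eqxx mulr1.
rewrite big1 ?addr0// => d' /negPf dd'.
by rewrite coordZ coord_dirv eq_sym dd' mulr0.
Qed.

Lemma rnd_dist h z : 0 < h -> `|rnd h z - z| <= h.
Proof.
move=> h0; apply: coord_norm_le => [|d]; first exact: ltW.
rewrite coordD coordN coord_rnd.
have := floor_itv (coord d z / h); rewrite ler_pdivlMr// ltr_pdivrMr//.
rewrite intrD mulrDl mul1r ler_norml; lra.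
Qed.

(** A move along one coordinate leaves the rounding of the others unchanged, so the rounded
    endpoints differ by a whole number of steps, namely a difference of floors. This makes the
    lattice estimates applicable to rounded points. *)
Lemma rnd_dir h d z (t : R) : 0 < h -> 0 <= t -> exists k : nat,
  rnd h (z + t *: dirv d) = rnd h z + (k%:R * h) *: dirv d /\ `|k%:R * h - t| <= h.
Proof.
move=> h0 t0; set a := coord d z.
have fl : Num.floor (a / h) <= Num.floor ((a + t) / h).
  by rewrite le_floor// ler_pM2r ?invr_gt0// lerDl.
have [k kE] : exists k : nat, Num.floor ((a + t) / h) = Num.floor (a / h) + k%:Z.
  exists `|Num.floor ((a + t) / h) - Num.floor (a / h)|%N.
  by rewrite gez0_abs ?subr_ge0// [RHS]addrC subrK.
exists k; split.
  apply: coord_inj => d'; rewrite coordD coordZ !coord_rnd coordD coordZ coord_dirv.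
  have [->|_] := eqVneq d' d; last by rewrite !mulr0 !addr0.
  by rewrite mulr1 -/a kE intrD mulrDl mulr1.
have := floor_itv (a / h); have := floor_itv ((a + t) / h).
rewrite kE !ler_pdivlMr// !ltr_pdivrMr// !intrD !mulrDl !mul1r ler_norml.
rewrite -[k%:~R]/(k%:R : R); lra.
Qed.

End DifferenceQuotients.

(** * Locally bounded sequences of discrete harmonic functions *)

Section Tame.
Context {R : realType} {n : nat}.
Variable hs : nat -> R.
Hypothesis hs_gt0 : forall m, 0 < hs m.
Hypothesis hs_cvg0 : hs @ \oo --> 0.
Implicit Types (z w c x : Cn R n) (d : bool * 'I_n) (r B : R)
  (G : nat -> Cn R n -> R).

Definition tame_at G c r B := \forall m \near \oo,
  forall z, `|z - c| <= r -> `|G m z| <= B /\ Lap (hs m) (G m) z = 0.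

(** Near each point, [r] and [B] serve all large [m]. The class is stable under [dq], so bounds of
    every order come from the bound on [G] alone. *)
Definition tame (Om : set (Cn R n)) G :=
  forall c, Om c -> exists r B, [/\ 0 < r, 0 < B & tame_at G c r B].

Definition dq d G m := diffq (hs m) d (G m).

Lemma hs_small r : 0 < r -> \forall m \near \oo, hs m <= r.
Proof. by move=> r0; apply: cvgr_le hs_cvg0 _ r0. Qed.

Lemma tame_atW G c r B r' B' : r' <= r -> B <= B' ->
  tame_at G c r B -> tame_at G c r' B'.
Proof.
move=> rr BB; apply: filterS => m H z zr.
have [H1 H2] := H z (le_trans zr rr); split => //; exact: le_trans BB.
Qed.

(** The gradient bound is used with radius [r / 8]: the ball of radius [3 r / 8] about a point of
    the half ball stays inside the ball of radius [r]. Harmonicity is kept because [Lap] commutes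
    with translations. *)
Lemma tame_at_dq G c r B d : 0 < r -> 0 < B -> tame_at G c r B ->
  tame_at (dq d G) c (r / 2) (gradient_const R n * B * (8 / r)).
Proof.
move=> r0 B0 tameG; near=> m => z zr.
have HG w : `|w - c| <= r -> `|G m w| <= B /\ Lap (hs m) (G m) w = 0.
  by move: w; near: m; exact: tameG.
have h0 := hs_gt0 m.
have hr : hs m <= r / 8 by near: m; apply: hs_small; rewrite divr_gt0.
split.
  rewrite /dq /diffq normrM normfV [`|hs m|]gtr0_norm// ler_pdivrMr//.
  have -> : gradient_const R n * B * (8 / r) * hs m = gradient_const R n * B * (hs m / (r / 8)).
    by field; rewrite gt_eqF.
  apply: discrete_gradient_bound => // w wz; apply: HG.
  rewrite -(subrK z w) -addrA (le_trans (ler_normD _ _))//; lra.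
have -> : dq d G m = fun w => (hs m)^-1 * (G m (nb (hs m) (true, d) w) - G m w).
  by apply/funext => w; rewrite /dq /diffq mulrC.
rewrite LapZ LapB Lap_nb.
have zr1 : `|z - c| <= r by lra.
have zr2 : `|nb (hs m) (true, d) z - c| <= r.
  by apply: le_trans (nb_dist _ (ltW h0) zr) _; lra.
by rewrite (HG _ zr1).2 (HG _ zr2).2 subrr mulr0.
Unshelve. all: by end_near. Qed.

Lemma tame_dq Om G d : tame Om G -> tame Om (dq d G).
Proof.
move=> HG c /HG[r [B [r0 B0 H]]].
exists (r / 2), (gradient_const R n * B * (8 / r)); split; first by rewrite divr_gt0.
  by rewrite !mulr_gt0 ?invr_gt0// (lt_le_trans ltr01)// gradient_const_ge1.
exact: tame_at_dq.
Qed.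

End Tame.

(** * Limits of discrete harmonic functions *)

Section UltraLimit.
Context {R : realType} {n : nat}.
Variables (U : set_system nat) (hs : nat -> R).
Hypothesis UU : UltraFilter U.
Hypothesis oo_sub_U : \oo `<=` U.
Hypothesis hs_gt0 : forall m, 0 < hs m.
Hypothesis hs_cvg0 : hs @ \oo --> 0.
Implicit Types (z w c x : Cn R n) (d : bool * 'I_n) (r B t : R)
  (G : nat -> Cn R n -> R).

Definition ulim (a : nat -> R) : R := lim (a @ U).

(** By compactness of [[- B, B]] there is a cluster point, and an ultrafilter converges to its
    cluster points. The same [U] serves all points and all difference quotients, so no diagonal
    subsequence is extracted. *)
Lemma ulim_cvg a B : (\forall m \near \oo, `|a m| <= B) -> a @ U --> ulim a.
Proof.
move=> /oo_sub_U aB; apply/cvg_ex.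
have PF : ProperFilter (a @ U) by exact: fmap_proper_filter.
have /(_ (a @ U) PF)[|l [_ lcl]] := @segment_compact R (- B) B.
  have aU : U (a @^-1` `[- B, B]%classic).
    by apply: filterS aB => m; rewrite /= in_itv/= ler_norml.
  exact: aU.
exists l => V Vl; have [//|UV] := in_ultra_setVsetC (a @^-1` V) UU.
have [x [/= + Vx]] := lcl (~` V) V UV Vl.
by [].
Qed.

Lemma hs_cvgU : hs @ U --> 0.
Proof. by move=> V /hs_cvg0 /oo_sub_U. Qed.

(* The rounding is essential: [G m] is controlled only along steps of length
   [hs m], so its values on different cosets of the lattice are unrelated. *)
Definition ulim_fun G z : R := ulim (fun m => G m (rnd (hs m) z)).

Lemma rnd_near z c r : 0 < r -> `|z - c| <= r / 2 ->
  \forall m \near \oo, `|rnd (hs m) z - c| <= r.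
Proof.
move=> r0 zr; have : 0 < r / 2 by rewrite divr_gt0.
move=> /(hs_small hs_cvg0); apply: filterS => m hr.
rewrite -(subrK z (rnd _ _)) -addrA (le_trans (ler_normD _ _))//.
by have := rnd_dist z (hs_gt0 m); lra.
Qed.

Lemma ulim_fun_cvg G c r B z : 0 < r -> tame_at hs G c r B -> `|z - c| <= r / 2 ->
  (fun m => G m (rnd (hs m) z)) @ U --> ulim_fun G z.
Proof.
move=> r0 HG zr; apply: (@ulim_cvg _ B); near=> m.
suff [] : `|G m (rnd (hs m) z)| <= B /\ Lap (hs m) (G m) (rnd (hs m) z) = 0 by [].
have H : `|rnd (hs m) z - c| <= r by near: m; exact: rnd_near.
have Hm : forall w, `|w - c| <= r -> `|G m w| <= B /\ Lap (hs m) (G m) w = 0.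
  by near: m; exact: HG.
exact: Hm.
Unshelve. all: by end_near. Qed.

Lemma shift_le z c d r t : `|z - c| <= r / 4 -> 0 <= t <= r / 4 ->
  `|z + t *: dirv d - c| <= r / 2.
Proof.
move=> zr /andP[t0 tr]; rewrite addrAC (le_trans (ler_normD _ _))// normZ_dirv.
by rewrite ger0_norm//; lra.
Qed.

Lemma lattice_step d c r z t : 0 < r -> `|z - c| <= r / 4 -> 0 <= t <= r / 4 ->
  \forall m \near \oo, exists k : nat,
   [/\ rnd (hs m) (z + t *: dirv d) = rnd (hs m) z + (k%:R * hs m) *: dirv d,
       `|k%:R * hs m - t| <= hs m & `|rnd (hs m) z - c| + k%:R * hs m <= r].
Proof.
move=> r0 zr /andP[t0 tr]; have : 0 < r / 8 by rewrite divr_gt0.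
move=> /(hs_small hs_cvg0); apply: filterS => m hr.
have [k [kE kt]] := rnd_dir d z (hs_gt0 m) t0.
exists k; split => //; have : `|rnd (hs m) z - c| <= hs m + r / 4.
  rewrite -(subrK z (rnd _ _)) -addrA (le_trans (ler_normD _ _))//.
  by have := rnd_dist z (hs_gt0 m); lra.
by move: kt; rewrite ler_norml; lra.
Qed.

Lemma ulim_lipschitz G d c r B z t : 0 < r ->
  tame_at hs G c r B -> tame_at hs (dq hs d G) c r B ->
  `|z - c| <= r / 4 -> 0 <= t <= r / 4 ->
  `|ulim_fun G (z + t *: dirv d) - ulim_fun G z| <= t * B.
Proof.
move=> r0 HG HdG zr tr; have tr2 := shift_le d zr tr.
have zr2 : `|z - c| <= r / 2 by lra.
have t0 : 0 <= t by case/andP: tr.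
have c1 := ulim_fun_cvg r0 HG tr2; have c2 := ulim_fun_cvg r0 HG zr2.
(* Rounding lengthens the displacement by at most one step [hs m], which vanishes in the limit. *)
have c3 : (fun m => (t + hs m) * B) @ U --> (t + 0) * B.
  by apply: cvgM; [apply: cvgD; [exact: cvg_cst|exact: hs_cvgU]|exact: cvg_cst].
rewrite -[X in _ <= X * B]addr0; apply: ler_cvg_to (cvg_norm (cvgB c1 c2)) c3 _.
apply: oo_sub_U; near=> m.
have [k [kE kt kr]] : exists k : nat,
   [/\ rnd (hs m) (z + t *: dirv d) = rnd (hs m) z + (k%:R * hs m) *: dirv d,
       `|k%:R * hs m - t| <= hs m & `|rnd (hs m) z - c| + k%:R * hs m <= r].
  by near: m; exact: lattice_step.
have HB : forall w, `|w - c| <= r -> `|dq hs d G m w| <= B /\ Lap (hs m) (dq hs d G m) w = 0.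
  by near: m.
have := lattice_lipschitz (hs_gt0 m) (fun w wr => (HB w wr).1) kr.
rewrite /= -kE => /le_trans; apply; rewrite ler_wpM2r//.
  have cr : `|c - c| <= r by rewrite subrr normr0 ltW.
  by case: (HB c cr) => /(le_trans (normr_ge0 _)).
by move: kt; rewrite ler_norml; lra.
Unshelve. all: by end_near. Qed.

Lemma ulim_taylor G d c r B z t : 0 < r -> tame_at hs G c r B ->
  tame_at hs (dq hs d G) c r B -> tame_at hs (dq hs d (dq hs d G)) c r B ->
  `|z - c| <= r / 4 -> 0 <= t <= r / 4 ->
  `|ulim_fun G (z + t *: dirv d) - ulim_fun G z - t * ulim_fun (dq hs d G) z|
   <= t ^+ 2 * B.
Proof.
move=> r0 HG HdG HddG zr tr; have tr2 := shift_le d zr tr.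
have zr2 : `|z - c| <= r / 2 by lra.
have t0 : 0 <= t by case/andP: tr.
have c1 := ulim_fun_cvg r0 HG tr2; have c2 := ulim_fun_cvg r0 HG zr2.
have c4 := ulim_fun_cvg r0 HdG zr2.
have c3 : (fun m => (t + hs m) ^+ 2 * B + hs m * B) @ U --> (t + 0) ^+ 2 * B + 0 * B.
  have c5 : (fun m => t + hs m) @ U --> t + 0.
    by apply: cvgD; [exact: cvg_cst|exact: hs_cvgU].
  by apply: cvgD; apply: cvgM; [exact: cvgM|exact: cvg_cst|exact: hs_cvgU|exact: cvg_cst].
rewrite -[X in _ <= X ^+ 2 * B]addr0 -[leRHS]addr0 -[X in _ <= _ + X](mul0r B).
apply: ler_cvg_to (cvg_norm (cvgB (cvgB c1 c2) (cvgM (cvg_cst t) c4))) c3 _.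
apply: oo_sub_U; near=> m.
have [k [kE kt kr]] : exists k : nat,
   [/\ rnd (hs m) (z + t *: dirv d) = rnd (hs m) z + (k%:R * hs m) *: dirv d,
       `|k%:R * hs m - t| <= hs m & `|rnd (hs m) z - c| + k%:R * hs m <= r].
  by near: m; exact: lattice_step.
have h0 := hs_gt0 m.
have HB : forall w, `|w - c| <= r -> `|dq hs d G m w| <= B /\ Lap (hs m) (dq hs d G m) w = 0.
  by near: m.
have HB2 : forall w, `|w - c| <= r -> `|dq hs d (dq hs d G) m w| <= B
   /\ Lap (hs m) (dq hs d (dq hs d G) m) w = 0.
  by near: m.
have := lattice_taylor h0 (fun w wr => (HB2 w wr).1) kr.
have B0 : 0 <= B.
  have cr : `|c - c| <= r by rewrite subrr normr0 ltW.
  by case: (HB c cr) => /(le_trans (normr_ge0 _)).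
have kh0 : 0 <= k%:R * hs m by rewrite mulr_ge0// ltW.
have xr : `|rnd (hs m) z - c| <= r by lra.
rewrite /= -kE; set x := rnd (hs m) z in xr *; set D := diffq (hs m) d (G m) x => Htay.
set dG := G m _ - G m x in Htay *.
rewrite -[X in `|X|]/(dG - t * dq hs d G m x).
(* The first summand is the lattice Taylor error; replacing the lattice length [k h] by [t] costs at
   most [h B]. *)
have -> : dG - t * dq hs d G m x = (dG - k%:R * hs m * D) + (k%:R * hs m - t) * D.
  by rewrite -[dq _ _ _ _ _]/D; ring.
rewrite (le_trans (ler_normD _ _))// lerD//.
  rewrite (le_trans Htay)// ler_wpM2r// ler_sqr ?nnegrE ?addr_ge0//; last exact: ltW.
  by move: kt; rewrite ler_norml; lra.
by rewrite normrM ler_pM//; exact: (HB x xr).1.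
Unshelve. all: by end_near. Qed.

End UltraLimit.

(** * Differentiability from Taylor estimates along the axes *)

Section Gradient.
Context {R : realType} {n : nat}.
Local Notation dir := (bool * 'I_n)%type.
Implicit Types (z w c y : Cn R n) (d : dir) (r B t : R).

(** The candidate differential: the linear form whose partial derivatives are the numbers [a d]. *)
Definition lincomb (a : dir -> R) z : R := \sum_d coord d z * a d.

Fact lincomb_is_linear a : linear (lincomb a).
Proof.
move=> k x y; rewrite /lincomb scaler_sumr -big_split; apply: eq_bigr => d _ /=.
by rewrite coordD coordZ mulrDl -mulrA.
Qed.
HB.instance Definition _ a :=
  GRing.isLinear.Build R (Cn R n) R *:%R (lincomb a) (lincomb_is_linear a).

Lemma lincomb_dirv a d : lincomb a (dirv d) = a d.
Proof.
rewrite /lincomb (bigD1 d)//= coord_dirv eqxx mul1r big1 ?addr0// => d' /negPf dd'.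
by rewrite coord_dirv dd' mul0r.
Qed.

Lemma continuous_sum_fin (T : topologicalType) (I : Type) (s : seq I)
    (f : I -> T -> R) (z : T) : (forall i, {for z, continuous (f i)}) ->
  {for z, continuous (fun x => \sum_(i <- s) f i x)}.
Proof.
move=> fc; elim: s => [|i s IH].
  rewrite (_ : (fun x => _) = cst 0); first exact: cvg_cst.
  by apply/funext => x; rewrite big_nil.
rewrite (_ : (fun x => _) = (fun x => f i x + \sum_(j <- s) f j x)).
  exact: (continuousD (fc i) IH).
by apply/funext => x; rewrite big_cons.
Qed.

Lemma lincomb_continuous a : continuous (lincomb a).
Proof.
move=> z; apply: continuous_sum_fin => d.
by apply: continuousM; [exact: coord_continuous|exact: cvg_cst].
Qed.

Section Taylor.
Variables (G : Cn R n -> R) (Gd : dir -> Cn R n -> R) (c : Cn R n) (r B : R).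
Hypothesis r_gt0 : 0 < r.
Hypothesis taylor : forall d z t, `|z - c| <= r -> 0 <= t <= r ->
  `|G (z + t *: dirv d) - G z - t * Gd d z| <= t ^+ 2 * B.
Hypothesis lipschitz : forall d d' z t, `|z - c| <= r -> 0 <= t <= r ->
  `|Gd d' (z + t *: dirv d) - Gd d' z| <= t * B.

(** The hypotheses concern [t >= 0] only, as lattice steps go forward; for negative [t] the two
    endpoints exchange roles. *)
Let signed_lipschitz d d' z t : `|z - c| <= r -> `|z + t *: dirv d - c| <= r ->
  `|t| <= r -> `|Gd d' (z + t *: dirv d) - Gd d' z| <= `|t| * B.
Proof.
move=> zr ztr tr; have [t0|t0] := leP 0 t.
  by rewrite ger0_norm in tr *; rewrite ?lipschitz ?t0.
rewrite ltr0_norm// in tr *; have := lipschitz d d' ztr (t := - t).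
by rewrite -addrA -scalerDl addrN scale0r addr0 distrC; apply; lra.
Qed.

(** For negative [t] the expansion is made at the other endpoint. Moving the derivative back to [z]
    costs a second [t^2 B], hence the factor 2. *)
Let signed_taylor d z t : `|z - c| <= r -> `|z + t *: dirv d - c| <= r ->
  `|t| <= r -> `|G (z + t *: dirv d) - G z - t * Gd d z| <= 2 * `|t| ^+ 2 * B.
Proof.
move=> zr ztr tr; have B0 : 0 <= B.
  have := lipschitz d d zr (t := r); rewrite lexx ltW// => /(_ isT).
  by move=> /(le_trans (normr_ge0 _)); rewrite pmulr_rge0.
have [t0|t0] := leP 0 t.
  rewrite ger0_norm// in tr *; have tt : 0 <= t <= r by rewrite t0.
  apply: (le_trans (taylor d zr tt)); rewrite ler_wpM2r//.
  by rewrite ler_peMl ?sqr_ge0//; lra.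
have L := signed_lipschitz d zr ztr tr.
rewrite ltr0_norm// in tr L *; have tt : 0 <= - t <= r by lra.
have zE : z + t *: dirv d + (- t) *: dirv d = z.
  by rewrite -addrA -scalerDl addrN scale0r addr0.
have := taylor d ztr tt; rewrite zE.
set z' := z + _ in L * => T.
have -> : G z' - G z - t * Gd d z =
  - (G z - G z' - - t * Gd d z') - - t * (Gd d z' - Gd d z) by ring.
rewrite (le_trans (ler_normB _ _))// normrN.
have -> : 2 * (- t) ^+ 2 * B = (- t) ^+ 2 * B + - t * (- t * B) by ring.
rewrite lerD// normrM gtr0_norm ?oppr_gt0// ler_wpM2l//.
by rewrite oppr_ge0 ltW.
Qed.

Let path (s : seq dir) y := c + \sum_(d <- s) coord d y *: dirv d.

Let taylor_path (s : seq dir) y : (size s)%:R * `|y| <= r ->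
  [/\ `|path s y - c| <= (size s)%:R * `|y|,
   forall d, `|Gd d (path s y) - Gd d c| <= (size s)%:R * `|y| * B &
   `|G (path s y) - G c - \sum_(d <- s) coord d y * Gd d c|
     <= (size s)%:R * ((size s)%:R + 2) * (`|y| ^+ 2 * B)].
Proof.
have y0 := normr_ge0 y.
elim: s => [|d s IH] /=.
  have -> : path [::] y = c by rewrite /path big_nil addr0.
  by rewrite !mul0r big_nil subr0 !subrr !normr0; split => // d; rewrite subrr normr0.
have -> : (size s).+1%:R * `|y| = (size s)%:R * `|y| + `|y|.
  by rewrite -natr1 mulrDl mul1r.
move=> sr; have sr' : (size s)%:R * `|y| <= r by lra.
have [I1 I2 I3] := IH sr'.
have pE : path (d :: s) y = path s y + coord d y *: dirv d.
  by rewrite /path big_cons [_ + \sum_(_ <- _) _]addrC addrA.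
have P1 : `|path (d :: s) y - c| <= (size s)%:R * `|y| + `|y|.
  rewrite pE addrAC (le_trans (ler_normD _ _))// lerD// normZ_dirv.
  exact: norm_coord.
have pr : `|path s y - c| <= r by exact: le_trans sr'.
have pr' : `|path s y + coord d y *: dirv d - c| <= r by rewrite -pE; exact: le_trans sr.
have sy : 0 <= (size s)%:R * `|y| by rewrite mulr_ge0.
have dr : `|coord d y| <= r.
  by apply: (le_trans (norm_coord _ _)); lra.
have B0 : 0 <= B.
  have := lipschitz d d pr (t := r); rewrite lexx ltW// => /(_ isT).
  by move=> /(le_trans (normr_ge0 _)); rewrite pmulr_rge0.
split => [//|d'|].
  rewrite pE; set p := path s y in I2 *.
  have -> x : x - Gd d' c = (x - Gd d' p) + (Gd d' p - Gd d' c) by ring.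
  rewrite (le_trans (ler_normD _ _))// mulrDl [leRHS]addrC lerD//.
  by rewrite (le_trans (signed_lipschitz _ _ _ _))// ler_wpM2r// norm_coord.
rewrite big_cons pE; set p := path s y in I2 I3 pr pr' *.
set S := \sum_(_ <- _) _ in I3 *; set cy := coord d y in pr' dr *.
have -> x : x - G c - (cy * Gd d c + S) =
   (G p - G c - S) + ((x - G p - cy * Gd d p) + cy * (Gd d p - Gd d c)) by ring.
have cyy : `|cy| <= `|y| by exact: norm_coord.
rewrite (le_trans (ler_normD _ _))//.
have H1 : `|cy * (Gd d p - Gd d c)| <= (size s)%:R * (`|y| ^+ 2 * B).
  rewrite normrM.
  have -> : (size s)%:R * (`|y| ^+ 2 * B) = `|y| * ((size s)%:R * `|y| * B) by ring.
  by rewrite ler_pM.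
have H2 : `|G (p + cy *: dirv d) - G p - cy * Gd d p| <= 2 * (`|y| ^+ 2 * B).
  apply: (le_trans (signed_taylor pr pr' dr)); rewrite -mulrA ler_pM2l//.
  by rewrite ler_wpM2r// ler_sqr.
have H3 := ler_normD (G (p + cy *: dirv d) - G p - cy * Gd d p) (cy * (Gd d p - Gd d c)).
have yB : 0 <= `|y| ^+ 2 * B by rewrite mulr_ge0// sqr_ge0.
have s0 : 0 <= (size s)%:R :> R by [].
move: (`|y| ^+ 2 * B) yB I3 H1 H2 => Y Y0 I3 H1 H2.
rewrite -natr1; have : 0 <= (size s)%:R * Y by rewrite mulr_ge0.
nra.
Qed.

(** The walk through all coordinates ends at [c + y] with an error [O(|y|^2)], hence [o(y)]. *)
Lemma taylor_is_diff : is_diff c G (lincomb (Gd ^~ c)).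
Proof.
pose N : R := (size (index_enum dir))%:R + 1.
have N0 : 0 < N by rewrite ltr_wpDl.
have est y : N * `|y| <= r ->
    `|G (y + c) - G c - lincomb (Gd ^~ c) y| <= N * (N + 2) * (`|y| ^+ 2 * `|B|).
  move=> yr; have sN : (size (index_enum dir))%:R <= N by rewrite lerDl.
  have sr : (size (index_enum dir))%:R * `|y| <= r.
    by apply: le_trans yr; rewrite ler_wpM2r.
  have [_ _] := taylor_path sr; rewrite /path -coord_decomp [c + y]addrC => /le_trans; apply.
  have YB : `|y| ^+ 2 * B <= `|y| ^+ 2 * `|B| by rewrite ler_wpM2l ?sqr_ge0// ler_norm.
  apply: (@le_trans _ _ ((size (index_enum dir))%:R *
      ((size (index_enum dir))%:R + 2) * (`|y| ^+ 2 * `|B|))).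
    by rewrite ler_wpM2l// mulr_ge0.
  by rewrite ler_wpM2r ?mulr_ge0 ?sqr_ge0// ler_pM// lerD2r.
have lc : continuous (lincomb (Gd ^~ c)) by exact: lincomb_continuous.
have key : G \o shift c = cst (G c) + lincomb (Gd ^~ c) +o_ (0 : Cn R n) id.
  apply/eqaddoP => _/posnumP[e].
  pose K := N * (N + 2) * `|B| + 1.
  have K0 : 0 < K by rewrite ltr_wpDl// !mulr_ge0// ?ltW// addr_gt0.
  have near0 (e' : R) : 0 < e' -> \forall x \near (0 : Cn R n), `|x| <= e'.
    by move=> e'0; apply: (@nbhs0_le _ ('rV[R]_n * 'rV[R]_n)%type).
  near=> y.
  have yr : N * `|y| <= r.
    by rewrite mulrC -ler_pdivlMr//; near: y; apply: near0; rewrite divr_gt0.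
  have yK : `|y| <= e%:num / K.
    by near: y; apply: near0; rewrite divr_gt0.
  rewrite -[X in `|X| <= _]/(G (y + c) - (G c + lincomb (Gd ^~ c) y)) opprD addrA.
  apply: (le_trans (est y yr)).
  rewrite /= ; have := ler_wpM2r (normr_ge0 y) yK.
  have -> : N * (N + 2) * (`|y| ^+ 2 * `|B|) = N * (N + 2) * `|B| * (`|y| * `|y|) by ring.
  have -> : e%:num / K * `|y| = e%:num * `|y| / K by ring.
  rewrite ler_pdivlMr// => /(le_trans _); apply; rewrite mulrC.
  by rewrite ler_wpM2l ?mulr_ge0// lerDl.
have dE := diff_unique lc key.
apply: DiffDef => //; apply/diff_locallyP; rewrite dE; split => //.
Unshelve. all: by end_near. Qed.

End Taylor.
End Gradient.

(** * Regularity of class C^2 through partial derivatives *)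

Section C2Criterion.
Context {R : realType} {n : nat}.
Local Notation dir := (bool * 'I_n)%type.
Implicit Types (z w c a b : Cn R n) (d : dir) (f g G : Cn R n -> R) (Om : set (Cn R n)).

Lemma near_differentiable f g z :
  (\forall w \near z, f w = g w) -> differentiable f z -> differentiable g z.
Proof.
move=> fg df; have fgz : f z = g z by exact: nbhs_singleton fg.
have dc : continuous ('d f z) by exact: diff_continuous.
have key : g \o shift z = cst (g z) + 'd f z +o_ (0 : Cn R n) id.
  have := diff_locally df; rewrite fgz => dfz.
  have fg0 : \forall y \near (0 : Cn R n), f (y + z) = g (y + z).
    by move: fg; rewrite (near_shift 0 z); apply: filterS => y; rewrite /= subr0.
  apply/eqaddoP => e e0; have /eqaddoP/(_ e e0) := dfz.
  apply: filterS2 fg0 => y fgy.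
  by rewrite -[X in `|X| <= _ -> _]/(f (y + z) - (g z + 'd f z y)) fgy.
have dE := diff_unique dc key.
by apply/diff_locallyP; rewrite dE; split.
Qed.

Lemma near_continuous f g z :
  (\forall w \near z, f w = g w) -> {for z, continuous f} -> {for z, continuous g}.
Proof.
move=> fg fc; rewrite /prop_for /continuous_at -(nbhs_singleton fg).
by apply: cvg_trans fc; apply: near_eq_cvg; apply: filterS fg.
Qed.

Lemma derive_lincomb G z a : differentiable G z ->
  'D_a G z = lincomb (fun d => 'D_(dirv d) G z) a.
Proof.
move=> dG; rewrite deriveE// [in LHS](coord_decomp a) linear_sum.
by apply: eq_bigr => d _; rewrite linearZ deriveE.
Qed.

Lemma near_derive_lincomb Om G (Gd : dir -> Cn R n -> R) a z : open Om -> Om z ->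
  (forall w, Om w -> differentiable G w) ->
  (forall d w, Om w -> 'D_(dirv d) G w = Gd d w) ->
  \forall w \near z, \sum_d coord d a * Gd d w = 'D_a G w.
Proof.
move=> oOm Omz dG GdE; apply: filterS (open_nbhs_nbhs (conj oOm Omz)) => w Omw.
by rewrite derive_lincomb; [apply: eq_bigr => d _; rewrite GdE|exact: dG].
Qed.

Lemma differentiable_sum_coef (f : dir -> Cn R n -> R) a z :
  (forall d, differentiable (f d) z) ->
  differentiable (fun w => \sum_d coord d a * f d w) z.
Proof.
move=> df; elim: (index_enum _) => [|d s IH].
  rewrite (_ : (fun w => _) = cst 0); first exact: differentiable_cst.
  by apply/funext => w; rewrite big_nil.
rewrite (_ : (fun w => _) =
    (coord d a \*: f d) + (fun w => \sum_(d <- s) coord d a * f d w)).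
  by apply: differentiableD => //; apply: differentiableZ.
by apply/funext => w; rewrite big_cons.
Qed.

Lemma derive_sum_coef (f : dir -> Cn R n -> R) a b z :
  (forall d, differentiable (f d) z) ->
  'D_b (fun w => \sum_d coord d a * f d w) z = \sum_d coord d a * 'D_b (f d) z.
Proof.
move=> df; suff : is_derive z b (fun w => \sum_d coord d a * f d w)
    (\sum_d coord d a * 'D_b (f d) z) by case.
elim: (index_enum _) => [|d s IH].
  rewrite (_ : (fun w => _) = cst 0) ?big_nil; first exact: is_derive_cst.
  by apply/funext => w; rewrite big_nil.
rewrite (_ : (fun w => _) =
    (coord d a \*: f d) + (fun w => \sum_(d <- s) coord d a * f d w)).
  by rewrite big_cons; apply: is_deriveD; apply: is_deriveZ; apply/derivableP/diff_derivable.
by apply/funext => w; rewrite big_cons.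
Qed.

Lemma derive_continuous_partials Om G (Gd : dir -> Cn R n -> R) a z :
  open Om -> Om z -> (forall w, Om w -> differentiable G w) ->
  (forall d w, Om w -> 'D_(dirv d) G w = Gd d w) ->
  (forall d, {for z, continuous (Gd d)}) -> {for z, continuous (fun w => 'D_a G w)}.
Proof.
move=> oOm Omz dG GdE Gdc.
apply: near_continuous (near_derive_lincomb a oOm Omz dG GdE) _.
apply: continuous_sum_fin => d.
by apply: continuousM; [exact: cvg_cst|exact: Gdc].
Qed.

(** [C2_on] quantifies over all directions. On the open set [Om] the derivative along [a] is the
    combination of the [Gd d] with the coordinates of [a], so differentiability and continuity
    transfer from the partials. *)
Lemma C2_on_partials Om G (Gd : dir -> Cn R n -> R) : open Om ->
  (forall w, Om w -> differentiable G w) ->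
  (forall d w, Om w -> 'D_(dirv d) G w = Gd d w) ->
  (forall d w, Om w -> differentiable (Gd d) w) ->
  (forall d b w, Om w -> {for w, continuous (fun x => 'D_b (Gd d) x)}) ->
  C2_on Om G.
Proof.
move=> oOm dG GdE dGd Gdc; split => //; split.
  move=> a z Omz; apply: near_differentiable (near_derive_lincomb a oOm Omz dG GdE) _.
  by apply: differentiable_sum_coef => d; exact: dGd.
move=> a b; apply: continuous_in_subspaceT => z /set_mem Omz.
have : \forall w \near z, \sum_d coord d a * 'D_b (Gd d) w = 'D_b ('D_a G) w.
  apply: filterS (open_nbhs_nbhs (conj oOm Omz)) => w Omw.
  rewrite -(near_eq_derive b (near_derive_lincomb a oOm Omw dG GdE)).
  by rewrite derive_sum_coef// => d; exact: dGd.
move=> /near_continuous; apply; apply: continuous_sum_fin => d.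
by apply: continuousM; [exact: cvg_cst|exact: Gdc].
Qed.

End C2Criterion.

(** * Smoothness and harmonicity of the limit *)

Section HarmonicLimit.
Context {R : realType} {n : nat}.
Local Notation dir := (bool * 'I_n)%type.
Variables (U : set_system nat) (hs : nat -> R) (Om : set (Cn R n)).
Hypothesis UU : UltraFilter U.
Hypothesis oo_sub_U : \oo `<=` U.
Hypothesis hs_gt0 : forall m, 0 < hs m.
Hypothesis hs_cvg0 : hs @ \oo --> 0.
Hypothesis open_Om : open Om.
Implicit Types (z w c a b : Cn R n) (d : dir) (G : nat -> Cn R n -> R).

Let UF := @ulim_fun R n U hs.

Lemma laplacianE (u : Cn R n -> R) z :
  laplacian u z = \sum_d 'D_(dirv d) ('D_(dirv d) u) z.
Proof.
rewrite -(pair_bigA _ (fun (e : bool) j => 'D_(dirv (e, j)) ('D_(dirv (e, j)) u) z))/=.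
by rewrite big_bool -big_split.
Qed.

(** Each application of [dq] halves the radius; the smallest radius and the sum of the bounds serve
    all orders up to three. The third order controls the shift error in [ulim_laplacian]. *)
Lemma tame_bounds G c : tame hs Om G -> Om c -> exists r B,
  [/\ 0 < r, tame_at hs G c r B,
   forall d, tame_at hs (dq hs d G) c r B,
   forall d d', tame_at hs (dq hs d' (dq hs d G)) c r B &
   forall d d' d'', tame_at hs (dq hs d'' (dq hs d' (dq hs d G))) c r B].
Proof.
move=> tG Omc; have [r [B0 [r0 B00 T0]]] := tG c Omc.
have gc0 : 0 < gradient_const R n by apply: lt_le_trans ltr01 (gradient_const_ge1).
have r1 : 0 < r / 2 by rewrite divr_gt0.
have r2 : 0 < r / 2 / 2 by rewrite divr_gt0.
have T1 d := tame_at_dq hs_gt0 hs_cvg0 d r0 B00 T0.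
have B10 : 0 < gradient_const R n * B0 * (8 / r) by rewrite !mulr_gt0 ?invr_gt0.
have T2 d d' := tame_at_dq hs_gt0 hs_cvg0 d' r1 B10 (T1 d).
set B1 := gradient_const R n * B0 * (8 / r) in B10 T1 T2.
have B20 : 0 < gradient_const R n * B1 * (8 / (r / 2)) by rewrite !mulr_gt0 ?invr_gt0.
have T3 d d' d'' := tame_at_dq hs_gt0 hs_cvg0 d'' r2 B20 (T2 d d').
set B2 := gradient_const R n * B1 * (8 / (r / 2)) in B20 T2 T3.
set B3 := gradient_const R n * B2 * _ in T3.
have B30 : 0 < B3 by rewrite !mulr_gt0 ?invr_gt0.
exists (r / 2 / 2 / 2), (B0 + B1 + B2 + B3); split => [|||d d'|d d' d''].
- by rewrite divr_gt0.
- by apply: tame_atW T0; lra.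
- by move=> d; apply: tame_atW (T1 d); lra.
- by apply: tame_atW (T2 d d'); lra.
- by apply: tame_atW (T3 d d' d''); lra.
Qed.

Lemma ulim_is_diff G c : tame hs Om G -> Om c ->
  is_diff c (UF G) (lincomb (fun d => UF (dq hs d G) c)).
Proof.
move=> tG Omc; have [r [B [r0 T0 T1 T2 _]]] := tame_bounds tG Omc.
have r4 : 0 < r / 4 by rewrite divr_gt0.
apply: (taylor_is_diff (Gd := fun d => UF (dq hs d G)) r4).
  by move=> d z t zr tr; exact: (ulim_taylor UU oo_sub_U hs_gt0 hs_cvg0 r0 T0 (T1 d) (T2 d d)).
by move=> d d' z t zr tr; exact: (ulim_lipschitz UU oo_sub_U hs_gt0 hs_cvg0 r0 (T1 d') (T2 d' d)).
Qed.

Lemma ulim_differentiable G c : tame hs Om G -> Om c -> differentiable (UF G) c.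
Proof. by move=> tG Omc; have := ulim_is_diff tG Omc. Qed.

Lemma ulim_derive G c d : tame hs Om G -> Om c ->
  'D_(dirv d) (UF G) c = UF (dq hs d G) c.
Proof.
move=> tG Omc; have dG := ulim_is_diff tG Omc.
by rewrite deriveE ?diff_val ?lincomb_dirv.
Qed.

Let tdq d G : tame hs Om G -> tame hs Om (dq hs d G).
Proof. exact: tame_dq. Qed.

Lemma ulim_C2 G : tame hs Om G -> C2_on Om (UF G).
Proof.
move=> tG; apply: (C2_on_partials (Gd := fun d => UF (dq hs d G))) => //.
- by move=> w; exact: ulim_differentiable.
- by move=> d w; exact: ulim_derive.
- by move=> d w; exact/ulim_differentiable/tdq.
- move=> d b w Omw.
  have := @derive_continuous_partials _ _ Om (UF (dq hs d G))
    (fun d' => UF (dq hs d' (dq hs d G))) b w open_Om Omw; apply.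
  + by move=> x; exact/ulim_differentiable/tdq.
  + by move=> d' x; exact/ulim_derive/tdq.
  + by move=> d'; exact/differentiable_continuous/ulim_differentiable/Omw/tdq/tdq.
Qed.

Lemma ulim_laplacian G z : tame hs Om G -> Om z -> laplacian (UF G) z = 0.
Proof.
move=> tG Omz; rewrite laplacianE.
have nearOm : \forall w \near z, Om w by exact: open_nbhs_nbhs (conj open_Om Omz).
rewrite (eq_bigr (fun d => UF (dq hs d (dq hs d G)) z)); last first.
  move=> d _; rewrite -(ulim_derive d (tdq d tG) Omz); apply: near_eq_derive.
  by apply: filterS nearOm => w; exact: ulim_derive.
have [r [B [r0 T0 T1 T2 T3]]] := tame_bounds tG Omz.
have zr : `|z - z| <= r / 2 by rewrite subrr normr0 divr_ge0 ?ltW.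
pose S m := \sum_d dq hs d (dq hs d G) m (rnd (hs m) z).
have cS : S @ U --> \sum_d UF (dq hs d (dq hs d G)) z.
  apply: cvg_big => [|d _]; [exact: add_continuous|].
  exact: (ulim_fun_cvg UU oo_sub_U hs_gt0 hs_cvg0 r0 (T2 d d) zr).
have c0 : (fun m => hs m * (#|{: dir}|%:R * B)) @ U --> 0 * (#|{: dir}|%:R * B).
  by apply: cvgM; [exact: hs_cvgU|exact: cvg_cst].
apply/eqP; rewrite -normr_le0 -[leRHS](mul0r (#|{: dir}|%:R * B)).
apply: ler_cvg_to (cvg_norm cS) c0 _; apply: oo_sub_U; near=> m.
have h0 := hs_gt0 m.
have hr : hs m <= r / 4 by near: m; apply: hs_small => //; rewrite divr_gt0.
have HG : forall w, `|w - z| <= r -> `|G m w| <= B /\ Lap (hs m) (G m) w = 0.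
  by near: m; exact: T0.
have HG3 : forall d w, `|w - z| <= r -> `|dq hs d (dq hs d (dq hs d G)) m w| <= B
   /\ Lap (hs m) (dq hs d (dq hs d (dq hs d G)) m) w = 0.
  by near: m; apply: filter_forall => d; exact: T3.
set x := rnd (hs m) z.
have xz : `|x - z| <= r / 4 by exact: le_trans (rnd_dist z h0) hr.
pose L := \sum_d (G m (x + hs m *: dirv d) + G m (x - hs m *: dirv d) - 2 * G m x).
have L0 : L = 0.
  by rewrite /L -LapE (HG x _).2//; lra.
(* Two forward quotients based at [x - h] give the centered second difference at [x], and these sum
   to [L / h^2 = 0]. In [S m] they are based at [x], one step further, so what remains is [h] times
   third quotients. *)
have -> : S m = \sum_d hs m * dq hs d (dq hs d (dq hs d G)) m (x - hs m *: dirv d).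
  rewrite -[RHS](addrK (hs m ^- 2 * L)) [X in _ - _ * X]L0 mulr0 subr0.
  rewrite /L mulr_sumr -big_split.
  apply: eq_bigr => d _; rewrite /dq /diffq -/x !subrK /=.
  by field; rewrite gt_eqF.
rewrite (le_trans (ler_norm_sum _ _ _))//.
have -> : hs m * (#|{: dir}|%:R * B) = \sum_(d : dir) hs m * B.
  by rewrite sumr_const -[RHS]mulr_natl; ring.
apply: ler_sum => d _; rewrite normrM gtr0_norm// ler_pM2l//.
apply: (HG3 d _ _).1.
rewrite addrAC (le_trans (ler_normB _ _))// normZ_dirv gtr0_norm//; lra.
Unshelve. all: by end_near. Qed.

Lemma ulim_harmonic G : tame hs Om G -> harmonic_on Om (UF G).
Proof.
by move=> tG; split; [exact: ulim_C2|move=> z; exact: ulim_laplacian].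
Qed.

End HarmonicLimit.

(** * Harmonic functions between sub- and superharmonic ones *)

Section DiscretePerron.
Context {R : realType} {n : nat}.
Implicit Types (z : Cn R n) (h : R) (F G g w : Cn R n -> R) (K W : set (Cn R n)).

Lemma Lap_sumE h G z : Lap h G z = \sum_s G (nb h s z) - valence R n * G z.
Proof. by rewrite /Lap sumrB; congr (_ - _); rewrite sumr_const mulr_natl. Qed.

Lemma Lap_dim0 h G z : n = 0%N -> Lap h G z = 0.
Proof. by move=> n0; rewrite /Lap big1// => -[? [? i]]; exfalso; move: i; rewrite n0 => -[]. Qed.

Lemma valence_ge1 : n = 0%N \/ 1 <= valence R n.
Proof.
have [->|n0] := posnP n; first by left.
by right; rewrite ler1n; apply/card_gt0P; exists (true, (true, Ordinal n0)).
Qed.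

(** Perron's method. The equations hold on [K], while the ordering is kept on the larger [W], which
    contains the neighbors of [K]; off [K] the competitors are only required to stay below [w]. The
    superharmonicity of [w] keeps averages of competitors below [w]. *)
Lemma discrete_harmonic_between h K W g w :
  K `<=` W -> (forall z s, K z -> W (nb h s z)) ->
  (forall z, W z -> g z <= w z) ->
  (forall z, K z -> 0 <= Lap h g z) -> (forall z, K z -> Lap h w z <= 0) ->
  exists F, (forall z, W z -> g z <= F z <= w z) /\ forall z, K z -> Lap h F z = 0.
Proof.
(* In dimension zero there are no neighbors, every function is discrete harmonic and [g] serves;
   otherwise one may divide by the valence. *)
move=> KW KnW gw Lg Lw; have [n0|v1] := valence_ge1.
  by exists g; split => [z Wz|z Kz]; rewrite ?lexx ?gw// Lap_dim0.
set v := valence R n in v1; have v0 : 0 < v by lra.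
pose GG := [set G | (forall z, W z -> G z <= w z) /\ forall z, K z -> 0 <= Lap h G z].
have GGg : GG g by [].
pose F z := sup [set G z | G in GG].
have hs z : W z -> has_sup [set G z | G in GG].
  move=> Wz; split; first by exists (g z); exists g.
  by exists (w z) => _ [G [Gw _] <-]; exact: Gw.
have GF G z : GG G -> W z -> G z <= F z.
  by move=> GGG Wz; apply: ub_le_sup; [case: (hs z Wz)|exists G].
have Fle z x : W z -> (forall G, GG G -> G z <= x) -> F z <= x.
  by move=> Wz H; apply: ge_sup; [case: (hs z Wz)|move=> _ [G GGG <-]; exact: H].
have Fw z : W z -> F z <= w z by move=> Wz; apply: Fle => // G [+ _]; exact.
have LF z : K z -> 0 <= Lap h F z.
  move=> Kz; rewrite Lap_sumE subr_ge0 -/v mulrC -ler_pdivlMr//; apply: Fle; first exact: KW.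
  move=> G GGG; rewrite ler_pdivlMr// mulrC.
  apply: (@le_trans _ _ (\sum_s G (nb h s z))).
    by have [_ /(_ z Kz)] := GGG; rewrite Lap_sumE subr_ge0.
  by apply: ler_sum => s _; apply: GF => //; exact: KnW.
(* [F'] averages [F] at all points of [K] at once; it is again a competitor,
   hence [F' <= F]. *)
pose F' z := if `[< K z >] then F z + Lap h F z / v else F z.
have FF' z : F z <= F' z.
  by rewrite /F'; case: asboolP => // /LF LFz; rewrite lerDl divr_ge0// ltW.
have F'E z : K z -> F' z = (\sum_s F (nb h s z)) / v.
  move=> Kz; rewrite /F'; case: asboolP => // _; rewrite Lap_sumE -/v.
  by field; rewrite gt_eqF.
have GGF' : GG F'.
  split => [z Wz|z Kz].
    have [Kz|nKz] := pselect (K z); last by rewrite /F'; case: asboolP => // _; exact: Fw.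
    rewrite F'E// ler_pdivrMr// mulrC; apply: (@le_trans _ _ (\sum_s w (nb h s z))).
      by apply: ler_sum => s _; exact/Fw/KnW.
    by have := Lw z Kz; rewrite Lap_sumE subr_le0.
  rewrite Lap_sumE -/v F'E// mulrC divfK ?gt_eqF// subr_ge0.
  by apply: ler_sum => s _; exact: FF'.
exists F; split => [z Wz|z Kz]; first by rewrite GF//= Fw.
apply/eqP; rewrite eq_le LF// andbT.
have := GF F' z GGF' (KW z Kz); rewrite /F'; case: asboolP => // _.
by rewrite gerDl pmulr_lle0 ?invr_gt0.
Qed.

End DiscretePerron.

(** * Consistency of the difference Laplacian *)

Section Consistency.
Context {R : realType} {n : nat}.
Local Notation dir := (bool * 'I_n)%type.
Implicit Types (z c : Cn R n) (d : dir) (h t : R) (G : Cn R n -> R) (Om : set (Cn R n)).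

Lemma is_derive_line G (e : Cn R n) z t l :
  is_derive (z + t *: e) e G l -> is_derive t 1 (fun s : R => G (z + s *: e)) l.
Proof.
have E : (fun h : R => h^-1 *: (((fun s : R => G (z + s *: e)) \o shift t) (h *: (1 : R)) -
      G (z + t *: e))) =
  (fun h : R => h^-1 *: ((G \o shift (z + t *: e)) (h *: e) - G (z + t *: e))).
  apply/funext => h /=; rewrite -[h *: (1 : R)]/(h * 1) mulr1.
  by congr (_ *: (G _ - _)); rewrite scalerDl addrCA.
move=> [De dE]; apply: DeriveDef; first by rewrite /derivable E.
by rewrite -dE /derive E.
Qed.

Lemma MVT_closed (f df : R -> R) (a b : R) : a < b ->
  (forall t, a <= t <= b -> is_derive t 1 f (df t)) ->
  exists2 c, a < c < b & f b - f a = df c * (b - a).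
Proof.
move=> ab D; have [||c cab fE] := @MVT R f df a b ab.
- by move=> t; rewrite in_itv/= => /andP[ta tb]; apply: D; rewrite !ltW.
- apply: derivable_within_continuous => t; rewrite in_itv/= => /D Dt.
  exact: ex_derive.
- by exists c.
Qed.

Lemma second_difference G (G1 G2 : Cn R n -> R) d z h : 0 < h ->
  (forall t, `|t| <= h ->
    is_derive (z + t *: dirv d) (dirv d) G (G1 (z + t *: dirv d)) /\
    is_derive (z + t *: dirv d) (dirv d) G1 (G2 (z + t *: dirv d))) ->
  exists t, `|t| <= h /\
    G (z + h *: dirv d) + G (z - h *: dirv d) - 2 * G z =
    h ^+ 2 * G2 (z + t *: dirv d).
Proof.
move=> h0 HD; pose f (g : Cn R n -> R) t := g (z + t *: dirv d).
have D1 t : `|t| <= h -> is_derive t 1 (f G) (f G1 t).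
  by move=> th; apply: is_derive_line; case: (HD t th).
have D2 t : `|t| <= h -> is_derive t 1 (f G1) (f G2 t).
  by move=> th; apply: is_derive_line; case: (HD t th).
(* [k] makes [chi h = chi 0]; two applications of the mean value theorem
   then give [k = G2 (z + t dirv d)]. *)
pose k := (f G h + f G (- h) - 2 * f G 0) / h ^+ 2.
pose chi t := f G t + f G (- t) - k * t ^+ 2.
have Dchi t : `|t| <= h -> is_derive t 1 chi (f G1 t - f G1 (- t) - 2 * k * t).
  move=> th; have D1t := D1 t th.
  have D1t' : is_derive (- t) 1 (f G) (f G1 (- t)) by apply: D1; rewrite normrN.
  have Dm : is_derive t 1 (f G \o -%R) (f G1 (- t) * - 1) by exact: is_derive1_comp.
  have Dq : is_derive t 1 (fun t => k * t ^+ 2) (2 * k * t).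
    apply: is_derive_eq; rewrite /GRing.scale/= ; ring.
  by apply: is_derive_eq; ring.
have [|xi /andP[xi0 xih]] := @MVT_closed chi
    (fun t => f G1 t - f G1 (- t) - 2 * k * t) 0 h h0.
  by move=> t /andP[t0 th]; apply: Dchi; rewrite ger0_norm.
have kE : k * h ^+ 2 = f G h + f G (- h) - 2 * f G 0.
  by rewrite /k divfK// sqrf_eq0 gt_eqF.
have -> : chi h - chi 0 = 0 by rewrite /chi kE oppr0; ring.
move=> /esym/eqP; rewrite mulf_eq0 subr0 (gt_eqF h0) orbF subr_eq0 => /eqP xiE.
have xi' : - xi < xi by lra.
have [|eta /andP[e1 e2]] := @MVT_closed (f G1) (f G2) (- xi) xi xi'.
  by move=> t /andP[t0 th]; apply: D2; rewrite ler_norml; lra.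
rewrite xiE => /esym etaE; exists eta; split; first by rewrite ler_norml; lra.
have {}etaE : f G2 eta = k.
  have xi2 : xi - - xi != 0 by rewrite gt_eqF//; lra.
  by apply: (mulIf xi2); rewrite etaE; ring.
by rewrite -[G2 _]/(f G2 eta) etaE [RHS]mulrC kE /f scale0r addr0 scaleNr.
Qed.

(** Only pure second derivatives along the axes enter, since second differences see nothing else.
    Superharmonicity of [w] is expressed by applying this to [- w]. *)
Definition subharmonic_C2 Om G := exists G1 G2 : dir -> Cn R n -> R,
  forall z, Om z -> [/\ {for z, continuous G},
    forall d, [/\ is_derive z (dirv d) G (G1 d z),
                  is_derive z (dirv d) (G1 d) (G2 d z) &
                  {for z, continuous (G2 d)}] &
    0 <= \sum_d G2 d z].

(** Each second difference is [h^2] times a pure second derivative at a nearby point, within [e / N]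
    of its value at [c] by continuity; the values at [c] have a nonnegative sum. The neighborhood is
    joint in [z] and [h], as required for the passage to compact sets. *)
Lemma subharmonic_Lap Om G c (e : R) : open Om -> subharmonic_C2 Om G -> Om c -> 0 < e ->
  \forall z \near c & h \near 0^'+, - (e * h ^+ 2) <= Lap h G z.
Proof.
move=> oOm [G1 [G2 HG]] Omc e0.
pose N : R := #|{: dir}|%:R + 1; have N0 : 0 < N by rewrite ltr_wpDl.
have eN : 0 < e / N by rewrite divr_gt0.
have H : \forall z \near c, Om z /\ forall d, `|G2 d c - G2 d z| < e / N.
  apply: filterI; first exact: open_nbhs_nbhs.
  apply: (@filter_forall _ dir (fun d z => `|G2 d c - G2 d z| < e / N) (nbhs c)) => d.
  have [_ /(_ d)[_ _ Gc] _] := HG c Omc.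
  by move/cvgrPdist_lt : Gc => /(_ _ eN).
have /nbhs_ballP[r /= r0 Hr] := H.
have r2 : 0 < r / 2 by rewrite divr_gt0.
exists (ball c (r / 2), [set h | 0 < h < r / 2]) => /=.
  split; first exact: nbhsx_ballx.
  near=> h; apply/andP; split; first by near: h; exact: nbhs_right_gt.
  by near: h; exact: nbhs_right_lt.
move=> [z h] /= [cz /andP[h0 hr]].
have near_c t d : `|t| <= h -> ball c r (z + t *: dirv d).
  move=> th; rewrite -ball_normE /= opprD addrA.
  rewrite (le_lt_trans (ler_normB _ _))// normZ_dirv.
  by move: cz; rewrite -ball_normE/=; lra.
rewrite LapE; apply: (@le_trans _ _ (\sum_d h ^+ 2 * (G2 d c - e / N))).
  rewrite -mulr_sumr mulrC -mulrN ler_pM2l ?exprn_gt0// sumrB sumr_const.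
  have [_ _ G20] := HG c Omc.
  have : (e / N) *+ #|{: dir}| <= e.
    rewrite -mulr_natr mulrAC ler_pdivrMr// ler_pM2l// lerDl//.
  lra.
apply: ler_sum => d _.
have [|t [th ->]] := @second_difference G (G1 d) (G2 d) d z h h0.
  by move=> t th; have [Omz _] := Hr _ (near_c t d th); have [_ /(_ d)[]] := HG _ Omz.
rewrite ler_pM2l ?exprn_gt0// lerBlDr -lerBlDl.
have [_ /(_ d)] := Hr _ (near_c t d th); rewrite ltr_norml; lra.
Unshelve. all: by end_near. Qed.

Lemma subharmonic_Lap_compact Om G K (e : R) : open Om -> subharmonic_C2 Om G ->
  compact K -> K `<=` Om -> 0 < e ->
  \forall h \near 0^'+, forall z, K z -> - (e * h ^+ 2) <= Lap h G z.
Proof.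
move=> oOm sG /compact_near_coveringP cK KOm e0.
apply: (cK R (0^'+) (fun h z => - (e * h ^+ 2) <= Lap h G z)) => z /KOm Omz.
exact: subharmonic_Lap oOm sG Omz e0.
Qed.

End Consistency.

(** * Compact exhaustion and passage to the limit *)

Section HarmonicBetween.
Context {R : realType} {n : nat}.
Local Notation dir := (bool * 'I_n)%type.
Implicit Types (z c : Cn R n) (d : dir) (h t : R) (g w : Cn R n -> R) (Om : set (Cn R n)).

(** The second condition puts every point at distance less than [1 / (m + 1)] inside [Om], so
    lattice neighbors stay in [Om] for small steps; being closed under limits of [z], it also gives
    compactness. *)
Definition exhaustion Om (m : nat) : set (Cn R n) :=
  [set z | `|z| <= m%:R /\ forall y, `|y - z| < m.+1%:R^-1 -> Om y].

Lemma exhaustion_sub Om m : exhaustion Om m `<=` Om.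
Proof. by move=> z [_]; apply; rewrite subrr normr0 invr_gt0. Qed.

Lemma compact_norm_le (r : R) : compact [set z : Cn R n | `|z| <= r].
Proof.
have cV : compact [set x : 'rV[R]_n | forall i, `[- r, r]%classic (x ord0 i)].
  by apply: (@rV_compact R n (fun=> `[- r, r]%classic)) => i; exact: segment_compact.
apply: subclosed_compact (compact_setX cV cV) _.
  have /continuous_closedP := @norm_continuous R ('rV[R]_n * 'rV[R]_n)%type.
  by move=> /(_ _ (@closed_le R r)).
move=> [x y] /= xyr; split => i /=; rewrite in_itv/= -ler_norml.
  exact: le_trans (norm_coord (x, y) (true, i)) xyr.
exact: le_trans (norm_coord (x, y) (false, i)) xyr.
Qed.

Lemma exhaustion_compact Om m : compact (exhaustion Om m).
Proof.
apply: subclosed_compact (@compact_norm_le m%:R) _ => [|z []//].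
move=> z zcl; have zc r : 0 < r -> exists2 x, exhaustion Om m x & `|z - x| < r.
  move=> r0; have [x [Ex]] := zcl _ (nbhsx_ballx z r r0).
  by rewrite -ball_normE; exists x.
split.
  apply/ler_addgt0Pl => e e0; have [x [xm _] zx] := zc e e0.
  by have := ler_normD (z - x) x; rewrite subrK; lra.
move=> y yz; have [|x [_ Ex] zx] := zc (m.+1%:R^-1 - `|y - z|); first by rewrite subr_gt0.
apply: Ex; apply: (le_lt_trans (ler_distD z _ _)).
by rewrite -ltrBrDl.
Qed.

Lemma exhaustion_ball Om c : open Om -> Om c -> exists r, 0 < r /\
  \forall m \near \oo, forall z, `|z - c| <= r -> exhaustion Om m z.
Proof.
move=> oOm Omc; have /nbhs_ballP[r /= r0 Hr] := open_nbhs_nbhs (conj oOm Omc).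
have r20 : 0 < r / 2 by rewrite divr_gt0.
exists (r / 2); split => //; near=> m => z zc.
have h1 : `|c| + r <= m%:R by near: m; exact: nbhs_infty_ger.
have h2 : m.+1%:R^-1 <= r / 2.
  by near: m; exact: (@cvgr_le _ _ _ _ (fun m : nat => m.+1%:R^-1) 0 (@cvg_harmonic R)).
split.
  by have := ler_normD (z - c) c; rewrite subrK; lra.
move=> y yz; apply: Hr; rewrite -ball_normE /=.
by rewrite distrC (le_lt_trans (ler_distD z _ _))// (splitr r) ltr_leD// (lt_le_trans yz).
Unshelve. all: by end_near. Qed.

Lemma normsq_le z (r : R) : `|z| <= r -> normsq z <= #|{: dir}|%:R * r ^+ 2.
Proof.
move=> zr; rewrite mulr_natl -sumr_const; apply: ler_sum => d _.
rewrite -[leLHS]real_normK ?num_real// ler_sqr ?nnegrE//.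
  exact: le_trans (norm_coord z d) zr.
exact: le_trans zr.
Qed.

Lemma discrete_harmonic_exhaustion Om g w m : open Om ->
  subharmonic_C2 Om g -> subharmonic_C2 Om (fun z => - w z) ->
  (forall z, Om z -> g z <= w z) ->
  exists h F, [/\ 0 < h, h <= m.+1%:R^-1,
    forall z, Om z -> `|z| <= m.+1%:R -> g z - m.+1%:R^-1 <= F z <= w z + m.+1%:R^-1 &
    forall z, exhaustion Om m z -> Lap h F z = 0].
Proof.
move=> oOm sg sw gw; pose k : R := m.+1%:R^-1; have k0 : 0 < k by rewrite invr_gt0.
pose N : R := #|{: dir}|%:R * m.+1%:R ^+ 2; have N0 : 0 <= N by rewrite mulr_ge0.
(* [N] bounds [normsq] on the ball of radius [m + 1], so [del * normsq] is at most [k] there. *)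
pose del := k / (N + 1); have del0 : 0 < del by rewrite divr_gt0// ltr_wpDl.
have delN : del * N <= k by rewrite mulrAC ler_pdivrMr ?ltr_wpDl// ler_pM2l// lerDl.
have cK := @exhaustion_compact Om m; have KOm := @exhaustion_sub Om m.
have [h [h0 hk Lg Lw]] : exists h, [/\ 0 < h, h <= k / 2,
    forall z, exhaustion Om m z -> - (del * h ^+ 2) <= Lap h g z &
    forall z, exhaustion Om m z -> - (del * h ^+ 2) <= Lap h (fun z => - w z) z].
  (* The bound [k / 2] makes [h] strictly less than [k], as the strict inequality in [exhaustion]
     demands of neighbors. *)
  near (0 : R)^'+ => h; exists h; split.
  - by near: h; exact: nbhs_right_gt.
  - by near: h; apply: nbhs_right_le; rewrite divr_gt0.
  - by near: h; exact: (subharmonic_Lap_compact oOm sg cK KOm del0).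
  - by near: h; exact: (subharmonic_Lap_compact oOm sw cK KOm del0).
(* Adding [q <= 0] to [g] and subtracting it from [w] absorbs the consistency
   error of the difference Laplacian at a cost of at most [k]. *)
pose q z := del * (normsq z - N).
pose W := [set z | Om z /\ `|z| <= m.+1%:R].
have qW z : W z -> - k <= q z <= 0.
  move=> [_ /normsq_le zN]; have := normsq_ge0 z; rewrite -/N in zN.
  rewrite /q mulrBr => z0.
  have := ler_wpM2l (ltW del0) zN; have := mulr_ge0 (ltW del0) z0; lra.
have Lq z : Lap h q z = del * (valence R n * h ^+ 2).
  by rewrite LapZ LapB Lap_normsq Lap_cst subr0.
have h2 : 0 <= h ^+ 2 by rewrite sqr_ge0.
have Lq' z : n = 0%N \/ del * h ^+ 2 <= Lap h q z.
  have [|v1] := @valence_ge1 R n; [by left|right].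
  by rewrite Lq ler_pM2l// ler_peMl.
have [|||||F [Fgw LF]] := @discrete_harmonic_between R n h (exhaustion Om m) W
    (fun z => g z + q z) (fun z => w z - q z).
- move=> z Kz; split; first exact: KOm.
  by case: Kz => zm _; rewrite (le_trans zm)// ler_nat.
- move=> z s Kz; have nz := nb_norm s z (ltW h0); split.
    by case: Kz => _; apply; rewrite nz -/k; lra.
  have := ler_normD (nb h s z - z) z; rewrite subrK nz -natr1.
  have k1 : k <= 1 by rewrite /k invf_le1// ler1n.
  by case: Kz => zm _; lra.
- by move=> z Wz; have := qW z Wz; have := gw z (proj1 Wz); lra.
- move=> z Kz; have [n0|Lqz] := Lq' z; first by rewrite Lap_dim0.
  by rewrite LapD; have := Lg z Kz; lra.
- move=> z Kz; have [n0|Lqz] := Lq' z; first by rewrite Lap_dim0.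
  rewrite LapB; have := Lw z Kz.
  rewrite (_ : (fun z => - w z) = (fun z => - 1 * w z)); last first.
    by apply/funext => x; rewrite mulN1r.
  by rewrite LapZ; lra.
exists h, F; split => //; first by rewrite -/k; lra.
move=> z Omz zm; have := Fgw z (conj Omz zm); have := qW z (conj Omz zm).
by rewrite -/k; lra.
Unshelve. all: by end_near. Qed.

Theorem harmonic_between Om g w : open Om ->
  subharmonic_C2 Om g -> subharmonic_C2 Om (fun z => - w z) ->
  (forall z, Om z -> g z <= w z) ->
  exists H, harmonic_on Om H /\ forall z, Om z -> g z <= H z <= w z.
Proof.
move=> oOm sg sw gw.
have /choice[hs /choice[F HF]] := fun m => @discrete_harmonic_exhaustion Om g w m oOm sg sw gw.
have gc z : Om z -> {for z, continuous g} by move=> Omz; case: sg => ? [? /(_ z Omz)[]].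
have wc z : Om z -> {for z, continuous w}.
  move=> Omz; case: sw => ? [? /(_ z Omz)[wc _ _]].
  have -> : w = fun z => - - w z by apply/funext => x; rewrite opprK.
  exact: continuousN wc.
have hs0 m : 0 < hs m by case: (HF m).
have harm : (fun m : nat => m.+1%:R^-1 : R) @ \oo --> 0 := @cvg_harmonic R.
have hsc : hs @ \oo --> 0.
  apply: (@squeeze_cvgr _ _ _ _ (cst 0) (fun m : nat => m.+1%:R^-1)) => //.
    by near=> m; rewrite ltW//=; case: (HF m).
  exact: cvg_cst.
have tF : tame hs Om F.
  move=> c Omc; have [r [r0 Hr]] := exhaustion_ball oOm Omc.
  have : \forall z \near c, `|g c - g z| < 1 /\ `|w c - w z| < 1.
    by apply: filterI; [have /cvgrPdist_lt := gc c Omc|have /cvgrPdist_lt := wc c Omc]; apply.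
  move=> /nbhs_ballP[r' /= r'0 Hr'].
  (* Near [c], [g] and [w] vary by less than 1 and [F m] leaves the interval between them by at most
     1, so 3 leaves room. Halving [r'] puts the closed ball inside the open one. *)
  exists (Num.min r (r' / 2)), (`|g c| + `|w c| + 3); split.
  - by rewrite lt_min r0 divr_gt0.
  - by rewrite ltr_wpDl// addr_ge0.
  near=> m => z; rewrite le_min => /andP[zr zr'].
  have Kz : exhaustion Om m z by move: z zr {zr'}; near: m.
  have [_ _ HFm HL] := HF m; split; last exact: HL.
  have [|gcz wcz] := Hr' z; first by rewrite -ball_normE/= distrC; lra.
  have zm : `|z| <= m.+1%:R by case: Kz => zm _; rewrite (le_trans zm)// ler_nat.
  have := HFm z (exhaustion_sub Kz) zm.
  have k1 : m.+1%:R^-1 <= 1 :> R by rewrite invf_le1// ler1n.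
  have := ler_norm (g c); have := ler_norm (- g c); have := ler_norm (w c); have := ler_norm (- w c).
  move: gcz wcz; rewrite !ltr_norml !normrN ler_norml.
  have := normr_ge0 (w c); have := normr_ge0 (g c).
  by move: (m.+1%:R^-1) k1 => k k1; lra.
have [U [UU oU]] := ultraFilterLemma (@eventually_filter).
exists (ulim_fun U hs F); split; first exact: ulim_harmonic.
move=> z Omz; have [r [r0 Hr]] := exhaustion_ball oOm Omz.
have rz : (fun m => rnd (hs m) z) @ \oo --> z.
  apply/cvgrPdist_le => e e0.
  have := hs_small hsc e0; apply: filterS => m; apply: le_trans.
  by rewrite distrC rnd_dist.
have [r1 [B [r10 B0 T]]] := tF z Omz.
have cF := ulim_fun_cvg UU oU hs0 hsc r10 T (z := z).
have {}cF : (fun m => F m (rnd (hs m) z)) @ U --> ulim_fun U hs F z.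
  by apply: cF; rewrite subrr normr0 divr_ge0 ?ltW.
have toU (f : nat -> R) (l : R) : f @ \oo --> l -> f @ U --> l.
  by move=> fl V /fl /oU.
(* The sandwich is taken at the rounded points, which tend to [z]; continuity of [g] and [w] carries
   it to the limit. *)
have Fb : \forall m \near \oo, g (rnd (hs m) z) - m.+1%:R^-1 <= F m (rnd (hs m) z)
    <= w (rnd (hs m) z) + m.+1%:R^-1.
  near=> m; have Kz : exhaustion Om m (rnd (hs m) z).
    have zr : `|rnd (hs m) z - z| <= r.
      by rewrite (le_trans (rnd_dist z (hs0 m)))//; near: m; exact: hs_small.
    by move: (rnd _ z) zr; near: m.
  have [_ _ HFm _] := HF m; apply: HFm; first exact: exhaustion_sub Kz.
  by case: Kz => zm _; rewrite (le_trans zm)// ler_nat.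
apply/andP; split.
  have c1 : (fun m => g (rnd (hs m) z) - m.+1%:R^-1) @ \oo --> g z - 0.
    by apply: cvgB => //; exact: (cvg_comp _ _ rz (gc z Omz)).
  rewrite -[leLHS]subr0; apply: ler_cvg_to (toU _ _ c1) cF _.
  by apply: oU; apply: filterS Fb => m /andP[].
have c1 : (fun m => w (rnd (hs m) z) + m.+1%:R^-1) @ \oo --> w z + 0.
  by apply: cvgD => //; exact: (cvg_comp _ _ rz (wc z Omz)).
rewrite -[leRHS]addr0; apply: ler_cvg_to cF (toU _ _ c1) _.
by apply: oU; apply: filterS Fb => m /andP[].
Unshelve. all: by end_near. Qed.

End HarmonicBetween.

(** * Subharmonicity of powers *)

Section LineCalculus.
Context {R : realType} {n : nat}.
Local Notation dir := (bool * 'I_n)%type.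
Variable Om : set (Cn R n).
Implicit Types (z c e : Cn R n) (d : dir) (t : R).

Lemma is_derive_of_line (f : Cn R n -> R) e z l :
  is_derive (0 : R) 1 (fun s : R => f (z + s *: e)) l -> is_derive z e f l.
Proof.
have E : (fun h : R => h^-1 *: (((fun s : R => f (z + s *: e)) \o shift (0 : R)) (h *: (1 : R)) -
      f (z + 0 *: e))) =
  (fun h : R => h^-1 *: ((f \o shift z) (h *: e) - f z)).
  apply/funext => h /=; rewrite -[h *: (1 : R)]/(h * 1) mulr1.
  by rewrite scale0r !addr0 [h *: e + z]addrC.
move=> [De dE]; apply: DeriveDef; first by rewrite /derivable -E.
by rewrite -dE /derive -E.
Qed.

Lemma is_derive_chain (phi : R -> R) (f : Cn R n -> R) e z m l :
  is_derive (f z) 1 phi m -> is_derive z e f l ->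
  is_derive z e (fun x => phi (f x)) (m * l).
Proof.
move=> Dphi Df; apply: is_derive_of_line.
have Df' : is_derive (0 : R) 1 (fun s : R => f (z + s *: e)) l.
  by apply: is_derive_line; rewrite scale0r addr0.
have Dphi' : is_derive (f (z + 0 *: e)) 1 phi m by rewrite scale0r addr0.
exact: (@is_derive1_comp _ phi (fun s : R => f (z + s *: e)) 0 m l).
Qed.

(** Carrying explicit derivatives along the axes makes the Laplacian of the barriers a formula.
    Continuity of [f1] is included so that the second derivatives of products and powers are
    continuous. *)
Definition C2_lines (f : Cn R n -> R) (f1 f2 : dir -> Cn R n -> R) :=
  forall z, Om z -> {for z, continuous f} /\
  forall d, [/\ is_derive z (dirv d) f (f1 d z),
                is_derive z (dirv d) (f1 d) (f2 d z),
                {for z, continuous (f1 d)} & {for z, continuous (f2 d)}].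

Lemma C2_lines_cst a : C2_lines (fun=> a) (fun _ _ => 0) (fun _ _ => 0).
Proof.
move=> z _; split => [|d]; first exact: cvg_cst.
split; [exact: is_derive_cst|exact: is_derive_cst|exact: cvg_cst|exact: cvg_cst].
Qed.

Lemma C2_linesD f f1 f2 g g1 g2 : C2_lines f f1 f2 -> C2_lines g g1 g2 ->
  C2_lines (fun z => f z + g z) (fun d z => f1 d z + g1 d z) (fun d z => f2 d z + g2 d z).
Proof.
move=> Cf Cg z Omz; have [cf Df] := Cf z Omz; have [cg Dg] := Cg z Omz.
split => [|d]; first exact: continuousD.
have [Df1 Df2 cf1 cf2] := Df d; have [Dg1 Dg2 cg1 cg2] := Dg d.
by split; [exact: is_deriveD|exact: is_deriveD|exact: continuousD|exact: continuousD].
Qed.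

Lemma C2_linesM f f1 f2 g g1 g2 : C2_lines f f1 f2 -> C2_lines g g1 g2 ->
  C2_lines (fun z => f z * g z) (fun d z => f z * g1 d z + g z * f1 d z)
    (fun d z => f z * g2 d z + 2 * (f1 d z * g1 d z) + g z * f2 d z).
Proof.
move=> Cf Cg z Omz; have [cf Df] := Cf z Omz; have [cg Dg] := Cg z Omz.
split => [|d]; first exact: continuousM.
have [Df1 Df2 cf1 cf2] := Df d; have [Dg1 Dg2 cg1 cg2] := Dg d.
split.
- exact: is_deriveM.
- have D1 : is_derive z (dirv d) (f * g1 d) (f z *: g2 d z + g1 d z *: f1 d z).
    exact: is_deriveM.
  have D2 : is_derive z (dirv d) (g * f1 d) (g z *: f2 d z + f1 d z *: g1 d z).
    exact: is_deriveM.
  have D3 : is_derive z (dirv d) (f * g1 d + g * f1 d)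
      ((f z *: g2 d z + g1 d z *: f1 d z) + (g z *: f2 d z + f1 d z *: g1 d z)).
    exact: is_deriveD.
  have -> : f z * g2 d z + 2 * (f1 d z * g1 d z) + g z * f2 d z =
      (f z *: g2 d z + g1 d z *: f1 d z) + (g z *: f2 d z + f1 d z *: g1 d z).
    by rewrite /GRing.scale/=; ring.
  exact: D3.
- by apply: continuousD; apply: continuousM.
- apply: continuousD; last exact: continuousM.
  apply: continuousD; first exact: continuousM.
  by apply: continuousM; [exact: cvg_cst|exact: continuousM].
Qed.

Lemma continuous_powR_pos (f : Cn R n -> R) (a : R) z : 0 < f z -> {for z, continuous f} ->
  {for z, continuous (fun x => f x `^ a)}.
Proof.
move=> fz cf; suff cp : {for f z, continuous (fun x : R => x `^ a)}.
  exact: (@continuous_comp (Cn R n) R R f (fun x => x `^ a) z cf cp).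
apply: differentiable_continuous; apply/derivable1_diffP.
by case: (is_derive1_powR a fz).
Qed.

Lemma C2_lines_powR f f1 f2 (a : R) : (forall z, Om z -> 0 < f z) -> C2_lines f f1 f2 ->
  C2_lines (fun z => f z `^ a) (fun d z => a * f z `^ (a - 1) * f1 d z)
    (fun d z => a * (a - 1) * f z `^ (a - 2) * f1 d z ^+ 2 + a * f z `^ (a - 1) * f2 d z).
Proof.
move=> f0 Cf z Omz; have [cf Df] := Cf z Omz; have fz := f0 z Omz.
split => [|d]; first exact: continuous_powR_pos.
have [Df1 Df2 cf1 cf2] := Df d; split.
- exact: is_derive_chain (is_derive1_powR a fz) Df1.
- have Dp := is_derive_chain (is_derive1_powR (a - 1) fz) Df1.
  have Da : is_derive z (dirv d) (a *: (fun x => f x `^ (a - 1)))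
      (a *: ((a - 1) * f z `^ (a - 1 - 1) * f1 d z)) by exact: is_deriveZ.
  have D3 : is_derive z (dirv d) ((a *: (fun x => f x `^ (a - 1))) * f1 d)
      ((a *: f z `^ (a - 1)) *: f2 d z + f1 d z *: (a *: ((a - 1) * f z `^ (a - 1 - 1) * f1 d z))).
    exact: is_deriveM.
  have -> : a * (a - 1) * f z `^ (a - 2) * f1 d z ^+ 2 + a * f z `^ (a - 1) * f2 d z =
     (a *: f z `^ (a - 1)) *: f2 d z + f1 d z *: (a *: ((a - 1) * f z `^ (a - 1 - 1) * f1 d z)).
    have -> : a - 2 = a - 1 - 1 by ring.
    by rewrite /GRing.scale/=; ring.
  exact: D3.
- apply: continuousM => //; apply: continuousM; first exact: cvg_cst.
  exact: continuous_powR_pos.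
- apply: continuousD; apply: continuousM => //.
  + by apply: continuousM; [exact: cvg_cst|exact: continuous_powR_pos].
  + exact: continuousM.
  + by apply: continuousM; [exact: cvg_cst|exact: continuous_powR_pos].
Qed.

Lemma C2_lines_subharmonic f f1 f2 : C2_lines f f1 f2 ->
  (forall z, Om z -> 0 <= \sum_d f2 d z) -> subharmonic_C2 Om f.
Proof.
move=> Cf f2_ge0; exists f1, f2 => z Omz; have [cf Df] := Cf z Omz.
by split => [//|d|]; [case: (Df d)|exact: f2_ge0].
Qed.

Lemma C2_on_lines (f : Cn R n -> R) : C2_on Om f ->
  open Om -> C2_lines f (fun d => 'D_(dirv d) f) (fun d => 'D_(dirv d) ('D_(dirv d) f)).
Proof.
move=> [df [ddf cf]] oOm z Omz; split => [|d].
  exact/differentiable_continuous/df.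
split.
- exact/derivableP/diff_derivable/df.
- exact/derivableP/diff_derivable/ddf.
- exact/differentiable_continuous/ddf.
- have := cf (dirv d) (dirv d); rewrite continuous_open_subspace//.
  by move=> /(_ z); rewrite inE; exact.
Qed.

End LineCalculus.

(** * Inequalities for real powers *)

Section PowerInequalities.
Context {R : realType}.
Implicit Types (x y s r a b c e : R).

Lemma powR_pred x b : 0 < x -> x `^ b = x * x `^ (b - 1).
Proof.
move=> x0; rewrite -{2}(powRr1 (ltW x0)) -powRD; first by congr (_ `^ _); ring.
by rewrite (gt_eqF x0) implybT.
Qed.

Lemma ler_powR_npos x y b : 0 < x -> x <= y -> b <= 0 -> y `^ b <= x `^ b.
Proof.
move=> x0 xy b0; have y0 : 0 < y by exact: lt_le_trans xy.
rewrite -[b]opprK !(powRN _ (- b)) lef_pV2 ?posrE ?powR_gt0//.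
by apply: ge0_ler_powR; rewrite ?nnegrE ?oppr_ge0//; exact: ltW.
Qed.

(** Write [(x + y)^a = x (x + y)^(a-1) + y (x + y)^(a-1)] and use that the power [a - 1 <= 0] is
    nonincreasing. *)
Lemma powR_subadditive x y a : 0 <= x -> 0 < y -> 0 < a <= 1 ->
  (x + y) `^ a <= x `^ a + y `^ a.
Proof.
move=> x0 y0 /andP[a0 a1]; have [->|xn0] := eqVneq x 0.
  by rewrite add0r lerDr powR_ge0.
have xp : 0 < x by rewrite lt_def xn0.
rewrite powR_pred ?addr_gt0// mulrDl lerD//.
  by rewrite (@powR_pred x)// ler_pM2l// ler_powR_npos ?lerDl ?subr_le0// ltW.
by rewrite (@powR_pred y)// ler_pM2l// ler_powR_npos ?lerDr ?subr_le0.
Qed.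

(* Young's inequality for the exponents [a / (a - 1)] and [a], by comparing
   [2 c s] with [r]. *)
Lemma powR_young r s c a : 0 < r -> 0 <= s -> 0 < c -> 1 <= a ->
  2 * c * (r `^ (a - 1) * s) <= r `^ a + 2 * c * (2 * c) `^ (a - 1) * s `^ a.
Proof.
move=> r0 s0 c0 a1; have c2 : 0 < 2 * c by rewrite mulr_gt0.
have [sr|rs] := leP (2 * c * s) r.
  apply: (@le_trans _ _ (r `^ a)); last by rewrite lerDl !mulr_ge0 ?powR_ge0// ltW.
  by rewrite (@powR_pred r a)// mulrCA mulrC ler_wpM2r ?powR_ge0.
apply: (@le_trans _ _ (2 * c * (2 * c) `^ (a - 1) * s `^ a)); last by rewrite lerDr powR_ge0.
have H : r `^ (a - 1) <= (2 * c) `^ (a - 1) * s `^ (a - 1).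
  rewrite -(powRM _ (ltW c2) s0); apply: ge0_ler_powR; rewrite ?nnegrE ?subr_ge0//; try exact: ltW.
  by rewrite mulr_ge0// ltW.
have a0 : 0 < a by lra.
rewrite -(mulr_powRB1 s0 a0).
have cs : 0 <= 2 * c * s by rewrite mulr_ge0// ltW.
by have := ler_wpM2l cs H; lra.
Qed.

End PowerInequalities.

(** * The subharmonic and superharmonic barriers *)

Section Barriers.
Context {R : realType} {n : nat}.
Local Notation dir := (bool * 'I_n)%type.
Variables (Om : set (Cn R n)) (u v U : Cn R n -> R)
  (u1 u2 v1 v2 U1 U2 : dir -> Cn R n -> R).
Hypotheses (Cu : C2_lines Om u u1 u2) (Cv : C2_lines Om v v1 v2) (CU : C2_lines Om U U1 U2).
Hypothesis u2_sum : forall z, Om z -> \sum_d u2 d z = 0.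
Hypothesis v2_sum : forall z, Om z -> \sum_d v2 d z = 0.
Hypothesis U2_sum : forall z, Om z -> \sum_d U2 d z = 0.
Hypothesis grad_orth : forall z, Om z -> \sum_d u1 d z * v1 d z = 0.
Hypothesis grad_norm : forall z, Om z -> \sum_d v1 d z ^+ 2 = \sum_d u1 d z ^+ 2.
Variable eps : R.
Hypothesis eps_gt0 : 0 < eps.

Let usq z := u z * u z.
Let sig z := usq z + eps.
(** The positive [eps] keeps [rho] and [sig] away from zero, so that their powers are of class C^2
    even at the zeros of [f] or [u]. *)
Let rho z := usq z + v z * v z + eps.
Let gam z := \sum_d u1 d z ^+ 2.

Let usq_ge0 z : 0 <= usq z. Proof. by rewrite /usq -expr2 sqr_ge0. Qed.
Let sig_gt0 z : 0 < sig z. Proof. by rewrite ltr_wpDl. Qed.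
Let sig_rho z : sig z <= rho z.
Proof. by rewrite lerD2r lerDl -expr2 sqr_ge0. Qed.
Let rho_gt0 z : 0 < rho z. Proof. exact: lt_le_trans (sig_rho z). Qed.
Let gam_ge0 z : 0 <= gam z. Proof. by apply: sumr_ge0 => d _; exact: sqr_ge0. Qed.

(** The Cauchy-Riemann equations enter here: the gradients of [u] and [v] are orthogonal of equal
    length and both Laplacians vanish, so each Laplacian below is a multiple of [gam]. *)
Let sum_quadratic z (k1 k2 k3 k4 k5 : R) : Om z ->
  \sum_d (k1 * u1 d z ^+ 2 + k2 * (u1 d z * v1 d z) + k3 * v1 d z ^+ 2
    + k4 * u2 d z + k5 * v2 d z) = (k1 + k3) * gam z.
Proof.
move=> Omz; rewrite !big_split/= -!mulr_sumr u2_sum// v2_sum// grad_orth// grad_norm//.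
rewrite -/(gam z); ring.
Qed.

Lemma C2_lines_ext (f : Cn R n -> R) (f1 f2 g1 g2 : dir -> Cn R n -> R) :
  (forall d z, f1 d z = g1 d z) -> (forall d z, f2 d z = g2 d z) ->
  C2_lines Om f f1 f2 -> C2_lines Om f g1 g2.
Proof.
move=> e1 e2; have -> : f1 = g1 by do 2 apply/funext => ?.
by have -> : f2 = g2 by do 2 apply/funext => ?.
Qed.

Lemma C2_linesZ (k : R) f f1 f2 : C2_lines Om f f1 f2 ->
  C2_lines Om (fun z => k * f z) (fun d z => k * f1 d z) (fun d z => k * f2 d z).
Proof.
move=> Cf; have H := C2_linesM (@C2_lines_cst R n Om k) Cf.
apply: C2_lines_ext H => d z /=; ring.
Qed.

Let usq1 (d : dir) z := 2 * (u z * u1 d z).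
Let usq2 (d : dir) z := 2 * (u1 d z ^+ 2 + u z * u2 d z).
Let rho1 (d : dir) z := 2 * (u z * u1 d z + v z * v1 d z).
Let rho2 (d : dir) z := 2 * (u1 d z ^+ 2 + u z * u2 d z + (v1 d z ^+ 2 + v z * v2 d z)).

Let Cusq : C2_lines Om usq usq1 usq2.
Proof. by apply: C2_lines_ext (C2_linesM Cu Cu) => d z; rewrite /usq1 /usq2; ring. Qed.

Let Csig : C2_lines Om sig usq1 usq2.
Proof. by apply: C2_lines_ext (C2_linesD Cusq (@C2_lines_cst R n Om eps)) => d z; ring. Qed.

Let Crho : C2_lines Om rho rho1 rho2.
Proof.
apply: C2_lines_ext (C2_linesD (C2_linesD Cusq (C2_linesM Cv Cv)) (@C2_lines_cst R n Om eps));
by move=> d z; rewrite /usq1 /usq2 /rho1 /rho2; ring.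
Qed.

Let pow1 (f : Cn R n -> R) (f1 : dir -> Cn R n -> R) (a : R) (d : dir) z :=
  a * f z `^ (a - 1) * f1 d z.
Let pow2 (f : Cn R n -> R) (f1 f2 : dir -> Cn R n -> R) (a : R) (d : dir) z :=
  a * (a - 1) * f z `^ (a - 2) * f1 d z ^+ 2 + a * f z `^ (a - 1) * f2 d z.

Let Crho_pow a : C2_lines Om (fun z => rho z `^ a) (pow1 rho rho1 a) (pow2 rho rho1 rho2 a).
Proof. by apply: C2_lines_powR. Qed.

Let Csig_pow a : C2_lines Om (fun z => sig z `^ a) (pow1 sig usq1 a) (pow2 sig usq1 usq2 a).
Proof. by apply: C2_lines_powR. Qed.

Let powR_pred2 x (a : R) : 0 < x -> x `^ (a - 1) = x * x `^ (a - 2).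
Proof. by move=> x0; rewrite powR_pred//; congr (_ * _ `^ _); ring. Qed.

(** From [|grad rho|^2 = 4 (rho - eps) gam] and [Delta rho = 4 gam]. *)
Let sum_rho_pow a z : Om z -> \sum_d pow2 rho rho1 rho2 a d z =
  4 * a * gam z * rho z `^ (a - 2) * (a * (rho z - eps) + eps).
Proof.
move=> Omz; rewrite /pow2; set X := rho z `^ (a - 2); set Y := rho z `^ (a - 1).
have YE : Y = rho z * X by exact: powR_pred2.
transitivity ((a * (a - 1) * X * 4 * usq z + a * Y * 2 +
    (a * (a - 1) * X * 4 * (v z * v z) + a * Y * 2)) * gam z).
  rewrite -(sum_quadratic _ (a * (a - 1) * X * 8 * u z * v z) _
    (a * Y * 2 * u z) (a * Y * 2 * v z) Omz).
  by apply: eq_bigr => d _; rewrite /rho1 /rho2 /usq; ring.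
by rewrite YE /rho; ring.
Qed.

(** From [|grad sig|^2 = 4 usq gam] and [Delta sig = 2 gam]. With [a = p / 2] the factor [2 a - 1]
    is [p - 1], positive because [p > 1]. *)
Let sum_sig_pow a z : Om z -> \sum_d pow2 sig usq1 usq2 a d z =
  2 * a * gam z * sig z `^ (a - 2) * ((2 * a - 1) * usq z + eps).
Proof.
move=> Omz; rewrite /pow2; set X := sig z `^ (a - 2); set Y := sig z `^ (a - 1).
have YE : Y = sig z * X by exact: powR_pred2.
transitivity ((a * (a - 1) * X * 4 * usq z + a * Y * 2 + 0) * gam z).
  rewrite -(sum_quadratic _ 0 _ (a * Y * 2 * u z) 0 Omz).
  by apply: eq_bigr => d _; rewrite /usq1 /usq2 /usq; ring.
by rewrite YE /sig; ring.
Qed.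

Let rho_eps z : 0 <= rho z - eps.
Proof. by rewrite /rho addrK addr_ge0// -expr2 sqr_ge0. Qed.

Lemma subharmonic_modulus_powR a : 0 <= a ->
  subharmonic_C2 Om (fun z => rho z `^ a).
Proof.
move=> a0; apply: C2_lines_subharmonic (Crho_pow a) _ => z Omz.
by rewrite sum_rho_pow// !mulr_ge0 ?powR_ge0// addr_ge0 ?mulr_ge0// ltW.
Qed.

(** In the Laplacian of [rho^(a-1) usq], the term from [Delta usq] gives [2 gam rho^(a-1)], and the
    other two are nonnegative for [a >= 1]. Multiplied by [4 a^2], the first one dominates
    [2 Delta rho^a], since [a (rho - eps) + eps <= a rho]. *)
Lemma superharmonic_barrier_ge1 a (C : R) : 1 <= a ->
  subharmonic_C2 Om (fun z => - (2 * (rho z `^ a -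
     2 * a ^+ 2 * (rho z `^ (a - 1) * usq z)) + C * U z)).
Proof.
move=> a1; have -> : (fun z => - (2 * (rho z `^ a -
     2 * a ^+ 2 * (rho z `^ (a - 1) * usq z)) + C * U z)) =
   (fun z => (4 * a ^+ 2 * (rho z `^ (a - 1) * usq z) + (- 2) * rho z `^ a) + (- C) * U z).
  by apply/funext => z; ring.
apply: C2_lines_subharmonic (C2_linesD (C2_linesD
  (C2_linesZ _ (C2_linesM (Crho_pow (a - 1)) Cusq)) (C2_linesZ _ (Crho_pow a)))
  (C2_linesZ _ CU)) _ => z Omz.
have sumE (k x y l m : R) (A B C' D E : dir -> R) :
    \sum_d (k * (x * A d + 2 * B d + y * C' d) + l * D d + m * E d) =
    k * (x * (\sum_d A d) + 2 * (\sum_d B d) + y * (\sum_d C' d))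
    + l * (\sum_d D d) + m * (\sum_d E d).
  by rewrite !big_split/= -!mulr_sumr !big_split/= -!mulr_sumr.
rewrite [leRHS](sumE _ _ _ _ _ (fun d => usq2 d z)
  (fun d => pow1 rho rho1 (a - 1) d z * usq1 d z) (fun d => pow2 rho rho1 rho2 (a - 1) d z)
  (fun d => pow2 rho rho1 rho2 a d z) (fun d => U2 d z)).
rewrite U2_sum// mulr0 addr0 !sum_rho_pow//.
have -> : \sum_d usq2 d z = 2 * gam z.
  transitivity ((2 + 0) * gam z); last by rewrite addr0.
  rewrite -(sum_quadratic _ 0 _ (2 * u z) 0 Omz).
  by apply: eq_bigr => d _; rewrite /usq2; ring.
have -> : \sum_d pow1 rho rho1 (a - 1) d z * usq1 d z =
    (a - 1) * rho z `^ (a - 1 - 1) * 4 * usq z * gam z.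
  transitivity (((a - 1) * rho z `^ (a - 1 - 1) * 4 * usq z + 0) * gam z); last by rewrite addr0.
  rewrite -(sum_quadratic _ ((a - 1) * rho z `^ (a - 1 - 1) * 4 * u z * v z) _ 0 0 Omz).
  by apply: eq_bigr => d _; rewrite /pow1 /rho1 /usq1 /usq; ring.
have -> : a - 1 - 1 = a - 2 by ring.
rewrite (powR_pred2 a (rho_gt0 z)).
set X := rho z `^ (a - 2); set X' := rho z `^ _.
have X0 : 0 <= X by exact: powR_ge0. have X'0 : 0 <= X' by exact: powR_ge0.
have b0 : 0 <= a - 1 by lra.
have g0 := gam_ge0 z; have s0 := usq_ge0 z; have r0 := rho_eps z; have e0 := ltW eps_gt0.
have a0 : 0 <= a by lra.
have a20 : 0 <= a ^+ 2 by rewrite sqr_ge0.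
have H1 : 0 <= a ^+ 2 * ((a - 1) * X * 4 * usq z * gam z).
  by do ?[done|apply: mulr_ge0].
have H2 : 0 <= a ^+ 2 * (usq z * (4 * (a - 1) * gam z * X' * ((a - 1) * (rho z - eps) + eps))).
  by do ?[done|apply: mulr_ge0|apply: addr_ge0].
have H3 : 0 <= a * gam z * X * ((a - 1) * eps).
  by do ?[done|apply: mulr_ge0].
lra.
Qed.

(** The choice of [q] gives [q Delta sig^a = 2 a gam sig^(a-2) (2 usq + q eps)], at least
    [4 a gam sig^(a-1)] because [q >= 2]. This dominates [4 a gam rho^(a-1)], as [sig <= rho] and
    [a <= 1], which in turn dominates [Delta rho^a]. The facts [H1], [H3], [H2] record the three
    gains in this order. *)
Lemma superharmonic_barrier_le1 a (q K : R) : 2^-1 < a -> a <= 1 -> q * (2 * a - 1) = 2 ->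
  subharmonic_C2 Om (fun z => - (rho z `^ a - q * sig z `^ a + q * (U z + K))).
Proof.
move=> a2 a1 qE; have -> : (fun z => - (rho z `^ a - q * sig z `^ a + q * (U z + K))) =
   (fun z => ((q * sig z `^ a + (- 1) * rho z `^ a) + (- q) * U z) + (- q * K)).
  by apply/funext => z; ring.
apply: C2_lines_subharmonic (C2_linesD (C2_linesD (C2_linesD
  (C2_linesZ _ (Csig_pow a)) (C2_linesZ _ (Crho_pow a)))
  (C2_linesZ _ CU)) (@C2_lines_cst R n Om _)) _ => z Omz.
have sumE (k l m : R) (A B C' : dir -> R) :
    \sum_d (k * A d + l * B d + m * C' d + 0) =
    k * (\sum_d A d) + l * (\sum_d B d) + m * (\sum_d C' d).
  by rewrite !big_split/= -!mulr_sumr big1_eq addr0.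
rewrite [leRHS](sumE _ _ _ (fun d => pow2 sig usq1 usq2 a d z)
  (fun d => pow2 rho rho1 rho2 a d z) (fun d => U2 d z)).
rewrite U2_sum// mulr0 addr0 sum_rho_pow// sum_sig_pow//.
have a0 : 0 < a by lra.
have q0 : 0 < q by have a3 : 0 < 2 * a - 1; [lra|rewrite -(pmulr_lgt0 _ a3) qE].
have mono : rho z `^ (a - 1) <= sig z `^ (a - 1).
  by apply: ler_powR_npos => //; rewrite subr_le0.
rewrite (powR_pred2 _ (rho_gt0 z)) (powR_pred2 _ (sig_gt0 z)) in mono.
set X := rho z `^ (a - 2) in mono *; set Y := sig z `^ (a - 2) in mono *.
have X0 : 0 <= X by exact: powR_ge0. have Y0 : 0 <= Y by exact: powR_ge0.
have ag : 0 <= a * gam z by rewrite mulr_ge0// ltW.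
have r0 := rho_eps z; have e0 := ltW eps_gt0; have q0' := ltW q0.
have a1' : 0 <= 1 - a by rewrite subr_ge0.
have H1 : 0 <= a * gam z * (Y * ((2 * (1 - a)) * eps) * q).
  by do ?[done|apply: mulr_ge0].
have H2 : 0 <= a * gam z * (X * ((1 - a) * (rho z - eps))).
  by do ?[done|apply: mulr_ge0].
have H3 : 0 <= a * gam z * (sig z * Y - rho z * X) by rewrite mulr_ge0// subr_ge0.
suff -> : q * (2 * a * gam z * Y * ((2 * a - 1) * usq z + eps)) +
  -1 * (4 * a * gam z * X * (a * (rho z - eps) + eps)) =
  2 * (a * gam z * (Y * ((2 * (1 - a)) * eps) * q)) +
  4 * (a * gam z * (X * ((1 - a) * (rho z - eps))))
  + 4 * (a * gam z * (sig z * Y - rho z * X)) by lra.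
have -> : usq z = sig z - eps by rewrite /sig addrK.
have -> : q * (2 * a * gam z * Y * ((2 * a - 1) * (sig z - eps) + eps)) =
  2 * a * gam z * Y * ((q * (2 * a - 1)) * (sig z - eps) + q * eps) by ring.
have -> : 2 * (a * gam z * (Y * (2 * (1 - a) * eps) * q)) =
  2 * (a * gam z * (Y * (q * eps  - (q * (2 * a - 1)) * eps))) by ring.
rewrite qE; ring.
Qed.

End Barriers.

(** * Harmonic conjugates *)

Section HarmonicConjugate.
Context {R : realType} {n : nat}.
Local Notation dir := (bool * 'I_n)%type.
Implicit Types (z a b : Cn R n) (d : dir) (s t : R) (Om : set (Cn R n)).

(** The mean value theorem is applied along [a] to the increment of [f] in direction [b], then along
    [b] to [f1]. *)
Lemma mixed_difference (f f1 f12 : Cn R n -> R) a b z s : 0 < s ->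
  (forall t t', 0 <= t <= s -> 0 <= t' <= s ->
    is_derive (z + t *: a + t' *: b) a f (f1 (z + t *: a + t' *: b)) /\
    is_derive (z + t *: a + t' *: b) b f1 (f12 (z + t *: a + t' *: b))) ->
  exists t t', [/\ 0 <= t <= s, 0 <= t' <= s &
    f (z + s *: a + s *: b) - f (z + s *: a) - f (z + s *: b) + f z =
    s ^+ 2 * f12 (z + t *: a + t' *: b)].
Proof.
move=> s0 HD; have s00 : 0 <= s <= s by rewrite lexx ltW.
have s01 : 0 <= (0 : R) <= s by rewrite lexx ltW.
pose phi t := f (z + s *: b + t *: a) - f (z + t *: a).
have Dphi t : 0 <= t <= s ->
    is_derive t 1 phi (f1 (z + t *: a + s *: b) - f1 (z + t *: a)).
  move=> ts; apply: is_deriveB; apply: is_derive_line.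
    by rewrite addrAC; case: (HD t s ts s00).
  by have [] := HD t 0 ts s01; rewrite scale0r addr0.
have [t /andP[t0 ts]] := MVT_closed s0 Dphi.
have tts : 0 <= t <= s by rewrite !ltW.
have Dpsi t' : 0 <= t' <= s ->
    is_derive t' 1 (fun x => f1 (z + t *: a + x *: b)) (f12 (z + t *: a + t' *: b)).
  by move=> ts'; apply: is_derive_line; case: (HD t t' tts ts').
have [t' /andP[t'0 t's]] := MVT_closed s0 Dpsi.
rewrite scale0r addr0 => -> E; exists t, t'; split => //; first by rewrite !ltW.
have -> : s ^+ 2 * f12 (z + t *: a + t' *: b) = phi s - phi 0 by rewrite E; ring.
by rewrite /phi !scale0r !addr0 [z + s *: b + _]addrAC; ring.
Qed.

(** The second difference over a small parallelogram is symmetric in [a] and [b], so [fab] and [fba]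
    agree at two points close to [z]; continuity concludes. *)
Lemma mixed_derivatives_eq (Om : set (Cn R n)) (f fa fb fab fba : Cn R n -> R) a b z :
  open Om -> Om z ->
  (forall w, Om w -> [/\ is_derive w a f (fa w), is_derive w b f (fb w),
    is_derive w b fa (fab w) & is_derive w a fb (fba w)]) ->
  {for z, continuous fab} -> {for z, continuous fba} -> fab z = fba z.
Proof.
move=> oOm Omz HD cab cba.
apply/eqP; rewrite -subr_eq0 -normr_le0; apply/ler_addgt0Pr => e e0; rewrite add0r.
have e2 : 0 < e / 2 by rewrite divr_gt0.
have : \forall w \near z, [/\ Om w, `|fab z - fab w| < e / 2 & `|fba z - fba w| < e / 2].
  move/cvgrPdist_lt/(_ _ e2) : cab => H1; move/cvgrPdist_lt/(_ _ e2) : cba => H2.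
  by apply: filterS3 (open_nbhs_nbhs (conj oOm Omz)) H1 H2 => w.
move=> /nbhs_ballP[r /= r0 Hr].
pose N := `|a| + `|b| + 1; have N0 : 0 < N by rewrite ltr_wpDl// addr_ge0.
pose s := r / 2 / N; have s0 : 0 < s by rewrite !divr_gt0.
have near_z x y t t' : `|x| + `|y| <= N -> 0 <= t <= s -> 0 <= t' <= s ->
    ball z r (z + t *: x + t' *: y).
  move=> xy /andP[t0 ts] /andP[t'0 t's].
  rewrite -ball_normE/= -addrA opprD addrA subrr sub0r normrN.
  rewrite (le_lt_trans (ler_normD _ _))// !normrZ !ger0_norm//.
  apply: (@le_lt_trans _ _ (s * N)).
    apply: (@le_trans _ _ (s * (`|x| + `|y|))); last by rewrite ler_pM2l.
    by rewrite mulrDr lerD// ler_wpM2r.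
  by rewrite /s divfK ?gt_eqF//; lra.
have ab : `|a| + `|b| <= N by rewrite lerDl.
have ba : `|b| + `|a| <= N by rewrite addrC.
have [|t1 [t1' [t1s t1s' E1]]] := @mixed_difference f fa fab a b z s s0.
  by move=> t t' ts ts'; have [Om' _ _] := Hr _ (near_z _ _ _ _ ab ts ts'); case: (HD _ Om').
have [|t2 [t2' [t2s t2s' E2]]] := @mixed_difference f fb fba b a z s s0.
  by move=> t t' ts ts'; have [Om' _ _] := Hr _ (near_z _ _ _ _ ba ts ts'); case: (HD _ Om').
have [_ K1 _] := Hr _ (near_z _ _ _ _ ab t1s t1s').
have [_ _ K2] := Hr _ (near_z _ _ _ _ ba t2s t2s').
have E : fab (z + t1 *: a + t1' *: b) = fba (z + t2 *: b + t2' *: a).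
  have s2 : s ^+ 2 != 0 by rewrite sqrf_eq0 gt_eqF.
  by apply: (mulfI s2); rewrite -E1 -E2 [z + s *: b + _]addrAC; ring.
rewrite E in K1; move: (fba (z + _ + _)) K1 K2 => x K1 K2.
by rewrite (le_trans (ler_distD x _ _))// [leRHS]splitr lerD 1?[`|x - _|]distrC// ltW.
Qed.

Lemma schwarz (Om : set (Cn R n)) (u : Cn R n -> R) a b z : open Om -> Om z ->
  C2_on Om u -> 'D_b ('D_a u) z = 'D_a ('D_b u) z.
Proof.
move=> oOm Omz [du [ddu cu]].
apply: (@mixed_derivatives_eq Om u (fun w => 'D_a u w) (fun w => 'D_b u w)
  (fun w => 'D_b (fun x => 'D_a u x) w) (fun w => 'D_a (fun x => 'D_b u x) w) a b z oOm Omz).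
- move=> w Omw; split; apply/derivableP/diff_derivable.
  + exact: du.
  + exact: du.
  + exact: ddu.
  + exact: ddu.
- have := cu a b; rewrite continuous_open_subspace//.
  by move=> /(_ z); rewrite inE; exact.
- have := cu b a; rewrite continuous_open_subspace//.
  by move=> /(_ z); rewrite inE; exact.
Qed.

Lemma sum_dir (F : dir -> R) : \sum_d F d = \sum_j (F (true, j) + F (false, j)).
Proof.
rewrite (eq_bigr (fun d => F (d.1, d.2))); last by case.
by rewrite -(pair_bigA _ (fun e j => F (e, j)))/= big_bool/= -big_split.
Qed.

Lemma derive_near_opp (f g : Cn R n -> R) a z :
  (\forall w \near z, f w = - g w) -> differentiable g z -> 'D_a f z = - 'D_a g z.
Proof.
by move=> fg dg; rewrite (near_eq_derive a fg) deriveN//; exact: diff_derivable.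
Qed.

Lemma conjugate_sums (f g : dir -> R) :
  (forall j, g (true, j) = - f (false, j)) -> (forall j, g (false, j) = f (true, j)) ->
  \sum_d f d * g d = 0 /\ \sum_d g d ^+ 2 = \sum_d f d ^+ 2.
Proof.
move=> gT gF; rewrite !sum_dir; split.
  by rewrite big1// => j _; rewrite gT gF; ring.
by apply: eq_bigr => j _; rewrite gT gF; ring.
Qed.

Section Conjugate.
Variables (Om : set (Cn R n)) (u v : Cn R n -> R).
Hypotheses (oOm : open Om) (hol : holomorphic_on Om u v) (hu : harmonic_on Om u).

Let vd d z := if d.1 then - 'D_(dirv (false, d.2)) u z else 'D_(dirv (true, d.2)) u z.

Lemma conjugate_partial d z : Om z -> 'D_(dirv d) v z = vd d z.
Proof.
case: d => [[] j] Omz; have [H1 H2] := hol.2 z Omz j.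
  exact: etrans (esym (opprK _)) (congr1 -%R (esym H2)).
exact: esym H1.
Qed.

(** [holomorphic_on] gives only first derivatives of [v]; by the Cauchy-Riemann equations these are,
    up to sign, partials of [u], which supplies the second-order regularity. In each variable the
    Laplacian of [v] is [D_y D_x u - D_x D_y u], zero by symmetry. *)
Lemma conjugate_harmonic : harmonic_on Om v.
Proof.
have [C2u _] := hu; have [du [ddu cu]] := C2u.
have dvd d w : Om w -> differentiable (vd d) w.
  move=> Omw; rewrite /vd; case: d.1; last exact: ddu.
  exact/differentiableN/ddu.
have Dvd (d : dir) b w : Om w -> 'D_b (vd d) w = (if d.1 then - 'D_b ('D_(dirv (false, d.2)) u) w
    else 'D_b ('D_(dirv (true, d.2)) u) w).
  move=> Omw; rewrite /vd; case: d.1 => //.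
  by rewrite -deriveN//; exact/diff_derivable/ddu.
split.
  apply: (C2_on_partials (Gd := vd)) => //.
  - by move=> w /hol.1[].
  - by move=> d w; exact: conjugate_partial.
  move=> d b w Omw.
  have cont x y : {for w, continuous ('D_y ('D_x u))}.
    have := cu x y; rewrite continuous_open_subspace//.
    by move=> /(_ w); rewrite inE; exact.
  apply: (@near_continuous _ _ (fun x => if d.1 then - 'D_b ('D_(dirv (false, d.2)) u) x
    else 'D_b ('D_(dirv (true, d.2)) u) x)).
    by apply: filterS (open_nbhs_nbhs (conj oOm Omw)) => x Omx; rewrite Dvd.
  by case: d.1; [exact/continuousN/cont|exact: cont].
move=> z Omz; rewrite laplacianE sum_dir big1// => j _.
have near_Om : \forall w \near z, Om w by exact: open_nbhs_nbhs.
have E1 := @derive_near_opp (fun w => 'D_(dirv (true, j)) v w)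
  (fun w => 'D_(dirv (false, j)) u w) (dirv (true, j)) z
  (filterS (fun w => @conjugate_partial (true, j) w) near_Om) (ddu _ z Omz).
have E2 := @near_eq_derive R (Cn R n) R (fun w => 'D_(dirv (false, j)) v w)
  (fun w => 'D_(dirv (true, j)) u w) z (dirv (false, j))
  (filterS (fun w => @conjugate_partial (false, j) w) near_Om).
have E3 := schwarz (dirv (true, j)) (dirv (false, j)) oOm Omz C2u.
have cancel (p q x y : R) : p = - x -> q = y -> y = x -> p + q = 0.
  by move=> -> -> ->; rewrite addNr.
have F : Filter (nbhs z) by exact: nbhs_filter.
exact: (cancel _ _ _ _ (E1 F) (E2 F) E3).
Qed.

Lemma conjugate_grad z : Om z ->
  \sum_d 'D_(dirv d) u z * 'D_(dirv d) v z = 0 /\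
  \sum_d ('D_(dirv d) v z) ^+ 2 = \sum_d ('D_(dirv d) u z) ^+ 2.
Proof.
move=> Omz.
apply: (@conjugate_sums (fun d => 'D_(dirv d) u z) (fun d => 'D_(dirv d) v z)) => j.
  exact: (conjugate_partial (true, j) Omz).
exact: (conjugate_partial (false, j) Omz).
Qed.

End Conjugate.
End HarmonicConjugate.

(** * Harmonic majorants of the modulus *)

Section HarmonicMajorants.
Context {R : realType}.

Lemma normr_powR_sqr (x a : R) : `|x| `^ (2 * a) = (x * x) `^ a.
Proof. by rewrite powRrM powR_mulrn// real_normK ?num_real// expr2. Qed.

Lemma modulus_powR_le (x y e a : R) : 0 <= e -> 0 <= a ->
  (Num.sqrt (x ^+ 2 + y ^+ 2)) `^ (2 * a) <= (x * x + y * y + e) `^ a.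
Proof.
move=> e0 a0; have xy0 : 0 <= x ^+ 2 + y ^+ 2 by rewrite addr_ge0 ?sqr_ge0.
rewrite powRrM powR_mulrn ?sqrtr_ge0// sqr_sqrtr//.
by rewrite ge0_ler_powR ?nnegrE ?addr_ge0// -?expr2 ?sqr_ge0// lerDl.
Qed.

Lemma harmonic_lines n (Om : set (Cn R n)) (u : Cn R n -> R) :
  open Om -> harmonic_on Om u ->
  C2_lines Om u (fun d z => 'D_(dirv d) u z) (fun d z => 'D_(dirv d) ('D_(dirv d) u) z) /\
  forall z, Om z -> \sum_d 'D_(dirv d) ('D_(dirv d) u) z = 0.
Proof.
move=> oOm [Cu Lu]; split; first exact: C2_on_lines.
by move=> z /Lu; rewrite laplacianE.
Qed.

(** [C] is chosen before all other data, whereas the regularization [eps] may depend on [u], [z0]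
    and [e]. *)
Lemma harmonic_majorant_bound (p : R) : 1 < p -> exists C : R, 0 < C /\
  forall n (Om : set (Cn R n)) z0 (u v U : Cn R n -> R) (e : R),
    open Om -> Om z0 -> holomorphic_on Om u v -> v z0 = 0 ->
    harmonic_on Om u -> harmonic_on Om U -> (forall z, Om z -> `|u z| `^ p <= U z) ->
    0 < e -> exists H, [/\ harmonic_on Om H,
      forall z, Om z -> (Num.sqrt (u z ^+ 2 + v z ^+ 2)) `^ p <= H z &
      H z0 <= C * U z0 + e].
Proof.
move=> p1; pose a := p / 2; have pE : p = 2 * a by rewrite /a; field.
have a0 : 0 < a by rewrite /a; lra.
have [a1|a1] := leP 1 a.
  pose c := 2 * a ^+ 2; have c1 : 1 <= c by rewrite /c expr2; nra.
  have c0 : 0 < c by lra.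
  have c20 : 0 < 2 * c by lra.
  (* This is the constant of [powR_young], which with [s = u^2] and [s^a = |u|^p <= U] yields [rho^a
     <= 2 (rho^a - c rho^(a-1) u^2) + C U]. *)
  exists (2 * c * (2 * c) `^ (a - 1)); split; first by rewrite mulr_gt0 ?powR_gt0.
  move=> n Om z0 u v U e oOm Omz0 hol vz0 hu hU uU e0.
  have hv := conjugate_harmonic oOm hol hu.
  have [Cu su] := harmonic_lines oOm hu; have [Cv sv] := harmonic_lines oOm hv.
  have [CU sU] := harmonic_lines oOm hU.
  have orth z (Omz : Om z) := (conjugate_grad hol Omz).1.
  have nrm z (Omz : Om z) := (conjugate_grad hol Omz).2.
  set C := 2 * c * _.
  (* At [z0], where [rho = s + eps] with [s = u^2], the barrier without [C U] is
     [2 P (s + eps - c s) <= 2 P eps], with [P = (s + eps)^(a-1)]. [K] bounds [2 P] for all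
     [eps <= 1], so [eps <= e / K] suffices. *)
  pose K := 2 * (u z0 * u z0 + 1) `^ (a - 1).
  have K0 : 0 < K by rewrite mulr_gt0// powR_gt0// ltr_wpDl// -expr2 sqr_ge0.
  pose eps := Num.min 1 (e / K).
  have eps0 : 0 < eps by rewrite lt_min ltr01 divr_gt0.
  have eps1 : eps <= 1 by rewrite ge_min lexx.
  have epsK : eps <= e / K by rewrite ge_min lexx orbT.
  have [|H [hH Hb]] := @harmonic_between R n Om _ _ oOm
    (subharmonic_modulus_powR Cu Cv su sv orth nrm eps0 (ltW a0))
    (superharmonic_barrier_ge1 Cu Cv CU su sv sU orth nrm eps0 C a1).
    move=> z Omz; set r := _ + eps; set s := u z * u z.
    have s0 : 0 <= s by rewrite /s -expr2 sqr_ge0.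
    have r0 : 0 < r by rewrite ltr_wpDl// addr_ge0// -expr2 sqr_ge0.
    have Y := powR_young r0 s0 c0 a1.
    have C0 : 0 <= C by rewrite mulr_ge0 ?powR_ge0 ?(ltW c20).
    have := uU z Omz; rewrite pE normr_powR_sqr -/s => /(ler_wpM2l C0) CU'.
    rewrite -/C -/c in Y *; lra.
  exists H; split => // [z Omz|].
    have /andP[H1 _] := Hb z Omz; apply: le_trans H1.
    by rewrite pE modulus_powR_le// ltW.
  have /andP[_ ] := Hb z0 Omz0; rewrite vz0 mulr0 addr0 -/c.
  set s := u z0 * u z0; have s0 : 0 <= s by rewrite /s -expr2 sqr_ge0.
  have se0 : 0 < s + eps by rewrite ltr_wpDl.
  rewrite (powR_pred a se0); set P := (s + eps) `^ (a - 1) => HU.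
  have P0 : 0 <= P by exact: powR_ge0.
  have PK : 2 * P <= K.
    rewrite ler_pM2l//; apply: ge0_ler_powR; [by rewrite subr_ge0|by rewrite nnegrE ltW| |].
      by rewrite nnegrE addr_ge0.
    by rewrite lerD2l.
  have H1 : 2 * P * eps <= e.
    apply: (@le_trans _ _ (K * eps)); first by rewrite ler_wpM2r// ltW.
    by rewrite mulrC -ler_pdivlMr.
  have H2 : 0 <= P * s * (c - 1) by apply: mulr_ge0; [exact: mulr_ge0|rewrite subr_ge0].
  lra.
have a12 : 2^-1 < a by rewrite /a ltr_pdivlMr// mulVf.
have a2 : 0 < 2 * a - 1 by lra.
pose q := 2 / (2 * a - 1); have q0 : 0 < q by rewrite divr_gt0.
have qE : q * (2 * a - 1) = 2 by rewrite divfK// gt_eqF.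
have q1 : 1 <= q by rewrite ler_pdivlMr// mul1r; lra.
exists q; split => // n Om z0 u v U e oOm Omz0 hol vz0 hu hU uU e0.
have hv := conjugate_harmonic oOm hol hu.
have [Cu su] := harmonic_lines oOm hu; have [Cv sv] := harmonic_lines oOm hv.
have [CU sU] := harmonic_lines oOm hU.
have orth z (Omz : Om z) := (conjugate_grad hol Omz).1.
have nrm z (Omz : Om z) := (conjugate_grad hol Omz).2.
(* At [z0] the quantities [rho] and [sig] coincide, so [rho^a - q sig^a <= 0] and only
   [q (U + eps^a)] remains; this [eps] makes [q eps^a = e]. *)
pose eps := (e / q) `^ a^-1; have eps0 : 0 < eps by rewrite powR_gt0// divr_gt0.
have epsE : eps `^ a = e / q.
  by rewrite /eps -powRrM mulVf ?gt_eqF// powRr1// ltW// divr_gt0.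
have [|H [hH Hb]] := @harmonic_between R n Om _ _ oOm
  (subharmonic_modulus_powR Cu Cv su sv orth nrm eps0 (ltW a0))
  (superharmonic_barrier_le1 Cu Cv CU su sv sU orth nrm eps0 (eps `^ a) a12 (ltW a1) qE).
  (* Subadditivity gives [sig^a <= |u|^p + eps^a <= U + eps^a], so the terms added to [rho^a] in the
     barrier have a nonnegative sum. *)
  move=> z Omz; set r := _ `^ a; set s := u z * u z.
  have s0 : 0 <= s by rewrite /s -expr2 sqr_ge0.
  have a01 : 0 < a <= 1 by rewrite a0 ltW.
  have := powR_subadditive s0 eps0 a01.
  have := uU z Omz; rewrite pE normr_powR_sqr -/s => sU' sub.
  have : 0 <= q * (U z + eps `^ a - (s + eps) `^ a) by rewrite mulr_ge0 ?(ltW q0)//; lra.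
  lra.
exists H; split => // [z Omz|].
  have /andP[H1 _] := Hb z Omz; apply: le_trans H1.
  by rewrite pE modulus_powR_le// ltW.
have /andP[_ ] := Hb z0 Omz0; rewrite vz0 mulr0 addr0 epsE.
have := powR_ge0 (u z0 * u z0 + eps) a; set P := _ `^ a => P0 HU.
have H1 : 0 <= (q - 1) * P by rewrite mulr_ge0// subr_ge0.
have H2 : q * (e / q) = e by rewrite mulrC divfK// gt_eqF.
lra.
Qed.

End HarmonicMajorants.

(** * From harmonic majorants to Hardy norms *)

Theorem theorem1p4 (R : realType) (p : R) (hp1 : 1 < p) :
  exists C : R, 0 < C /\
  forall (n : nat) (Om : set (Cn R n)) (z0 : Cn R n) (u v : Cn R n -> R),
    open Om -> connected Om -> Om z0 ->
    holomorphic_on Om u v -> v z0 = 0 -> hp p Om u ->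
    Hp p Om u v /\ Hp_norm p Om z0 u v <= C * hp_norm p Om z0 u.
Proof.
have [C [C0 HC]] := harmonic_majorant_bound hp1.
have p0 : 0 < p by lra.
exists (C `^ p^-1); split; first exact: powR_gt0.
move=> n Om z0 u v oOm _ Omz0 hol vz0 [hu [U [hU uU]]].
pose modp z := (Num.sqrt (u z ^+ 2 + v z ^+ 2)) `^ p.
have majorant W : harmonic_on Om W -> (forall z, Om z -> `|u z| `^ p <= W z) ->
    forall e, 0 < e -> exists H, [/\ harmonic_on Om H,
      forall z, Om z -> modp z <= H z & H z0 <= C * W z0 + e].
  by move=> hW uW e; exact: HC.
split.
  split; first exact: hol.
  split; first by split; [exact: hu|exists U].
  split; first exact: conjugate_harmonic hol hu.
  (* A majorant of [|f|^p] also majorizes [|v|^p]; any positive error will do here. *)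
  have [H [hH modH _]] := majorant U hU uU 1 ltr01.
  exists H; split; [exact: hH|move=> z Omz; apply: le_trans (modH z Omz)].
  apply: ge0_ler_powR; [exact: ltW|by rewrite nnegrE|by rewrite nnegrE sqrtr_ge0|].
  by rewrite -sqrtr_sqr ler_sqrt ?addr_ge0 ?sqr_ge0// lerDr sqr_ge0.
rewrite /Hp_norm /hp_norm; set A := majorant_values _ (fun z => `|u z| `^ p) _.
set B := majorant_values _ _ _.
have A0 : lbound A 0.
  by move=> _ [W [_ uW] <-]; apply: le_trans (uW z0 Omz0); exact: powR_ge0.
have B0 : lbound B 0.
  by move=> _ [W [_ mW] <-]; apply: le_trans (mW z0 Omz0); exact: powR_ge0.
(* [inf] is a genuine greatest lower bound only for a nonempty set bounded below, so both facts are
   established for [A] and for [B]. *)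
have An0 : A !=set0 by exists (U z0), U.
have infA0 : 0 <= inf A by exact: lb_le_inf.
have infB0 : 0 <= inf B.
  have [H [hH modH _]] := majorant U hU uU 1 ltr01.
  by apply: lb_le_inf => //; exists (H z0), H.
(* Every majorant [W] of [|u|^p] gives majorants of [|f|^p] with value at most [C * W z0 + e] at
   [z0], for every [e > 0]. *)
have infBA : inf B <= C * inf A.
  rewrite mulrC -ler_pdivrMr//; apply: lb_le_inf => // _ [W [hW uW] <-].
  rewrite ler_pdivrMr// mulrC; apply/ler_addgt0Pr => e e0.
  have [H [hH modH HW]] := majorant W hW uW e e0.
  by apply: le_trans HW; apply: ge_inf; [exists 0|exists H].
rewrite -powRM ?(ltW C0)//; apply: ge0_ler_powR; rewrite ?nnegrE ?invr_ge0//.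
  exact: ltW.
by rewrite mulr_ge0// ltW.
Qed.
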